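(* Let $(\Omega,\mathcal{F},\mathbb{P})$ be a complete probability space with filtration $\{\mathcal{F}_t\}_{t\ge0}$, let $w_1,\dots,w_N$ be independent standard one-dimensional Brownian motions with $(w_1,\dots,w_N)$ $\mathcal{F}_t$-adapted, and let $\Delta_1,\dots,\Delta_N\in\mathbb{R}^{n\times n}$ be constant matrices. Define $\bar A(t)=A+\frac1t\sum_{i=1}^N\Delta_iw_i(t)$ for $t>0$ (the time average of the noisy estimate $\hat A=A+\sum_i\Delta_i\dot w_i$ of $A$), and let $P$ solve $$\dot P=\bar A(t)^TP+P\bar A(t)-PBR^{-1}B^TP+Q,\qquad P(0)\in\mathcal{S}^n_+.$$ Then $\lim_{t\to\infty}P(t)=P^*$ with probability one.
   Context: $A\in\mathbb{R}^{n\times n}$, $B\in\mathbb{R}^{n\times m}$ with $(A,B)$ stabilizable; $Q=Q^T\ge0$ (taken $>0$ in this setting), $R=R^T>0$, $(A,Q^{1/2})$ observable. $P^*$ is the unique symmetric positive definite solution of $0=A^TP+PA-PBR^{-1}B^TP+Q$. $\mathcal{S}^n_+$ is the set of real symmetric positive definite $n\times n$ matrices. *)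

(* Defs.v *)
From HB Require Import structures.
From mathcomp Require Import all_boot all_order all_algebra.
From mathcomp Require Import all_classical all_reals all_analysis.
From mathcomp Require Import complex.
Set Implicit Arguments. Unset Strict Implicit. Unset Printing Implicit Defensive.
Import Order.TTheory GRing.Theory Num.Theory.
Import numFieldNormedType.Exports.
Local Open Scope classical_set_scope.
Local Open Scope ring_scope.

Section Defs.
Variable R : realType.

Definition posdef n (M : 'M[R]_n) : Prop :=
  M^T = M /\ forall x : 'cV[R]_n, x != 0 -> 0 < (x^T *m M *m x) 0 0.

Definition possemidef n (M : 'M[R]_n) : Prop :=
  M^T = M /\ forall x : 'cV[R]_n, 0 <= (x^T *m M *m x) 0 0.

Definition hurwitz n (M : 'M[R]_n) : Prop :=
  forall z : R[i], root (map_poly (fun x : R => real_complex R x) (char_poly M)) z ->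
    complex.Re z < 0.

Definition stabilizable n m (A : 'M[R]_n) (B : 'M[R]_(n, m)) : Prop :=
  exists K : 'M[R]_(m, n), hurwitz (A - B *m K).

(* (A,C) observable: the unobservable subspace
   (kernel of the Kalman observability matrix) is trivial *)
Definition observable n p (A : 'M[R]_n) (C : 'M[R]_(p, n)) : Prop :=
  forall x : 'cV[R]_n, (forall k, (k < n)%N -> C *m (A ^+ k) *m x = 0) -> x = 0.

Definition ARE n m (A : 'M[R]_n) (B : 'M[R]_(n, m)) (Q : 'M[R]_n)
  (Rm : 'M[R]_m) (P : 'M[R]_n) : Prop :=
  A^T *m P + P *m A - P *m B *m invmx Rm *m B^T *m P + Q = 0.

End Defs.

Section Prob.
Context {R : realType} {d : measure_display} {T : measurableType d}.

Definition complete_prob (Pr : probability T R) : Prop :=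
  forall N : set T, measurable N -> Pr N = 0%E ->
    forall A : set T, A `<=` N -> measurable A.

Definition filtration (F : R -> set (set T)) : Prop :=
  (forall t, 0 <= t -> sigma_algebra setT (F t) /\ F t `<=` measurable) /\
  (forall s t, 0 <= s -> s <= t -> F s `<=` F t).

Definition measurable_wrt (G : set (set T)) (X : T -> R) : Prop :=
  forall B : set R, measurable B -> G (X @^-1` B).

Definition mutually_independent (Pr : probability T R) (I : finType)
  (X : I -> T -> R) : Prop :=
  forall B : I -> set R, (forall i, measurable (B i)) ->
    Pr (\bigcap_(i in [set: I]) (X i @^-1` B i)) =
    (\prod_(i : I) Pr (X i @^-1` B i))%E.

Definition centered_normal (Pr : probability T R) (v : R) (X : T -> R) : Prop :=
  forall B : set R, measurable B -> Pr (X @^-1` B) = normal_prob 0 (Num.sqrt v) B.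

Definition indep_std_BMs (Pr : probability T R) (N : nat)
  (w : 'I_N -> R -> T -> R) : Prop :=
  (exists Z : set T, measurable Z /\ Pr Z = 0%E /\
     forall om, ~ Z om -> forall i, w i 0 om = 0 /\
        {within [set t : R | 0 <= t], continuous (fun t => w i t om)}) /\
  (forall (k : nat) (ts : nat -> R), 0 <= ts 0%N ->
     (forall j, (j < k)%N -> ts j < ts j.+1) ->
     let X := fun (ij : 'I_N * 'I_k) (om : T) =>
       w ij.1 (ts ij.2.+1) om - w ij.1 (ts ij.2) om in
     mutually_independent Pr X /\
     forall ij : 'I_N * 'I_k, centered_normal Pr (ts ij.2.+1 - ts ij.2) (X ij)).

End Prob.

Definition Abar {R : realType} {T : Type} n N (A : 'M[R]_n)
  (Delta : 'I_N -> 'M[R]_n) (w : 'I_N -> R -> T -> R) (om : T) (t : R)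
  : 'M[R]_n :=
  A + t^-1 *: (\sum_(i < N) w i t om *: Delta i).

Definition solves_DRE {R : realType} n m (Abar_t : R -> 'M[R]_n)
  (B : 'M[R]_(n, m)) (Q : 'M[R]_n) (Rm : 'M[R]_m) (Pf : R -> 'M[R]_n) : Prop :=
  (forall t : R, 0 < t -> forall i j : 'I_n,
     is_derive t 1 (fun s => Pf s i j)
       (((Abar_t t)^T *m Pf t + Pf t *m Abar_t t
        - Pf t *m B *m invmx Rm *m B^T *m Pf t + Q : 'M[R]_n) i j)) /\
  (forall i j : 'I_n, (fun s => Pf s i j) @ at_right 0 --> Pf 0 i j).

(* Main.v *)
Require Import Defs.
From HB Require Import structures.
From mathcomp Require Import all_boot all_order all_algebra.
From mathcomp Require Import all_classical all_reals all_analysis.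
From mathcomp Require Import measurable_realfun.
From mathcomp Require Import ring lra zify.
Import Order.TTheory GRing.Theory Num.Theory.
Import numFieldNormedType.Exports.
Local Open Scope classical_set_scope.
Local Open Scope ring_scope.

(* Pathwise, the perturbation w_i(t)/t tends to 0 at infinity, and near 0 it is O(t^(-3/4)), hence
   integrable; both facts come from Gaussian tails, Borel-Cantelli and dyadic chaining.
   Integrability at 0 makes a Gronwall estimate for P - P^T available in spite of the singular
   coefficient, so P stays symmetric; since Q > 0, it also stays positive definite.
   For the limit, compare P with multiples of P*: if P x = a P* x then, with S = B R^-1 B^T and
   E the perturbation,
     x^T P' x = (1 - a) x^T (a P* S P* + Q) x + a x^T (E^T P* + P* E) x,
   so as E -> 0 the functions a(t) = 1 +- delta +- c exp (- q (t - T) / 2) are barriers: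
   (1 - 2 delta) P* <= P(t) <= (1 + 2 delta) P* for all large t. *)

(** * Gaussian tails and dyadic chaining *)

(** Any bounds O(t^(1-c)) at infinity and O(t^c) at 0 with c > 0 would serve for the paths. The
    value c = 1/4 comes from thresholds of 2^((k+j)/4) standard deviations at scale k and level j: a
    fourth-power bound on the Gaussian tail then gives a multiple of 4^-(k+j), which beats the 2^j
    intervals of level j. One estimate covers both ends, with base lengths 2^k for infinity and 2^-k
    for 0. Symmetry of P is assumed at time 0 only, and the coefficient is unbounded there, so P and
    P^T cannot be identified by the standard uniqueness theorem; their difference is estimated
    directly. The barriers need information only at contact vectors, where the equation of P*
    eliminates A. Positivity of Q supplies a rate q > 0 with q P* <= Q; half of it drives the
    barrier, the other half absorbs the perturbation. *)

Section GaussianTail.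
Variable R : realType.

(** The exponent is split into two equal halves: one is bounded using |x| >= a, the other is the
    exponent of a normal density of variance 2 s^2, whose total mass is 1. The factor [Num.sqrt 2]
    is the ratio of the two peaks. *)
Lemma normal_pdf_tail_le (s a x : R) : 0 < s -> 0 <= a -> a <= `|x| ->
  normal_pdf 0 s x <=
  Num.sqrt 2 * expR (- (a ^+ 2 / (4 * s ^+ 2))) * normal_pdf 0 (Num.sqrt 2 * s) x.
Proof.
move=> s0 a0 ax.
have r0 : 0 < Num.sqrt 2 :> R by rewrite sqrtr_gt0.
rewrite !normal_pdfE ?mulf_neq0 ?gt_eqF//.
rewrite /normal_fun !subr0 exprMn sqr_sqrtr//.
have -> : normal_peak s = Num.sqrt 2 * normal_peak (Num.sqrt 2 * s).
  rewrite /normal_peak exprMn sqr_sqrtr// -(mulrA 2).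
  move: (s ^+ 2 * pi) => u; rewrite -(mulrnAr 2 u) (sqrtrM (u *+ 2))//.
  by rewrite invfM mulrA divff ?mul1r// gt_eqF.
rewrite -!(mulrA (Num.sqrt 2)) ler_pM2l// [leRHS]mulrCA ler_pM2l; last first.
  by apply: normal_peak_gt0; rewrite mulf_neq0 ?gt_eqF.
rewrite -expRD ler_expR.
have -> : - x ^+ 2 / (s ^+ 2 *+ 2) =
    - (x ^+ 2 / (4 * s ^+ 2)) + - x ^+ 2 / (2 * s ^+ 2 *+ 2).
  by field; rewrite gt_eqF.
rewrite lerD2r lerN2.
rewrite ler_pM2r ?invr_gt0 ?mulr_gt0 ?exprn_gt0//.
by rewrite -[x ^+ 2]real_normK ?num_real// ler_pXn2r ?nnegrE.
Qed.

Lemma normal_prob_tail (s a : R) : 0 < s -> 0 <= a ->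
  (normal_prob 0 s [set x : R | (a < `|x|)%R] <=
  (Num.sqrt 2 * expR (- (a ^+ 2 / (4 * s ^+ 2))))%:E)%E.
Proof.
move=> s0 a0; set c := _ * _.
have c0 : 0 <= c by rewrite mulr_ge0 ?expR_ge0.
have mV : measurable [set x : R | a < `|x|].
  have -> : [set x : R | a < `|x|] = (Num.norm : R -> R) @^-1` `]a, +oo[%classic.
    by apply/seteqP; split => x /=; rewrite in_itv/= andbT.
  by rewrite -[X in measurable X]setTI; exact: normr_measurable.
have mpdf t : measurable_fun setT (fun x : R => (normal_pdf 0 t x)%:E).
  by apply/measurable_EFinP; exact: measurable_normal_pdf.
rewrite /normal_prob.
apply: (@le_trans _ _ (\int[lebesgue_measure]_(x in [set x : R | (a < `|x|)%R])
    (c%:E * (normal_pdf 0 (Num.sqrt 2 * s) x)%:E))%E).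
  apply: ge0_le_integral => //=.
  - by move=> x _; rewrite lee_fin normal_pdf_ge0.
  - exact: measurable_funS (mpdf _).
  - by apply: measurable_funeM; exact: measurable_funS (mpdf _).
  - by move=> x /ltW ax; rewrite -EFinM lee_fin; exact: normal_pdf_tail_le.
rewrite ge0_integralZl_EFin//=; last 2 first.
- by move=> x _; rewrite lee_fin normal_pdf_ge0.
- exact: measurable_funS (mpdf _).
rewrite -[leRHS]mule1; apply: lee_wpmul2l; first by rewrite lee_fin.
rewrite -(integral_normal_pdf 0 (Num.sqrt 2 * s)).
apply: (@ge0_subset_integral _ _ _ lebesgue_measure _ _ mV) => //; first exact: mpdf.
by move=> x _; rewrite lee_fin normal_pdf_ge0.
Qed.

(** For y proportional to 2^(m/2), the fourth power turns the exponential into a multiple of 4^-m,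
    which is what the counting of dyadic intervals requires. *)
Lemma expRN_le_pow4 (y : R) : 0 < y -> expR (- y) <= (4 / y) ^+ 4.
Proof.
move=> y0; rewrite expRN -[4 / y]invf_div exprVn lef_pV2 ?posrE ?expR_gt0//; last first.
  by rewrite exprn_gt0// divr_gt0.
(* [expR y = expR (y / 4) ^+ 4] and [expR x >= 1 + x] *)
have -> : expR y = expR (y / 4) ^+ 4.
  by rewrite -expRM_natl; congr expR; field.
have h := expR_ge1Dx (y / 4).
rewrite ler_pXn2r// ?nnegrE ?expR_ge0 ?divr_ge0 ?(ltW y0)//.
by apply: le_trans h; rewrite lerDr.
Qed.

End GaussianTail.

Section Chaining.
Variable R : realType.

(* The k-th dyadic grid is the (k-1)-th one refined: an even node is inherited,
   and an odd node is one level-k increment away from an inherited node. *)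
Lemma dyadic_chaining (f : R -> R) (h : R) (b : nat -> R) : f 0 = 0 ->
  (forall j, 0 <= b j) ->
  (forall j l, (l < 2 ^ j)%N ->
    `|f (l.+1%:R * (h / 2 ^+ j)) - f (l%:R * (h / 2 ^+ j))| <= b j) ->
  forall J l, (l <= 2 ^ J)%N ->
    `|f (l%:R * (h / 2 ^+ J))| <= \sum_(j < J.+1) b j.
Proof.
move=> f0 b0 incr; elim=> [|J IH] l lJ.
  rewrite big_ord1/=; case: l lJ => [|[|//]] _.
    by rewrite mul0r f0 normr0.
  by have := incr 0%N 0%N isT; rewrite mul0r f0 subr0.
have halve p : p.*2%:R * (h / 2 ^+ J.+1) = p%:R * (h / 2 ^+ J).
  rewrite -muln2 natrM exprS; field.
  by rewrite expf_neq0.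
have [p [lE | lE]] : exists p, l = p.*2 \/ l = p.*2.+1.
  exists l./2; rewrite -{1 3}(odd_double_half l).
  by case: (odd l); [right | left].
  rewrite lE halve big_ord_recr/= (le_trans (IH _ _))//; last by rewrite lerDl.
  by move: lJ; rewrite lE expnS; lia.
rewrite big_ord_recr/= lE.
have pJ : (p.*2 < 2 ^ J.+1)%N by rewrite -lE.
have := incr J.+1 p.*2 pJ; rewrite halve => h1.
rewrite -[f (_ * _)](subrK (f (p%:R * (h / 2 ^+ J)))) addrC.
rewrite (le_trans (ler_normD _ _))// lerD// IH//.
by move: pJ; rewrite expnS; lia.
Qed.

Lemma geometric_sum_le (r : R) (n : nat) : 0 <= r -> r < 1 ->
  \sum_(j < n) r ^+ j <= (1 - r)^-1.
Proof.
move=> r0 r1.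
rewrite -[leRHS]mul1r ler_pdivlMr ?subr_gt0// mulrC -opprB mulNr -subrX1 opprB.
by rewrite gerBl exprn_ge0.
Qed.

(** On dyadic points the chain costs at most a geometric series; continuity carries the bound to
    every t, since the grids become dense. *)
Lemma chaining_bound (f : R -> R) (h g r : R) : 0 < h -> 0 <= g ->
  0 <= r -> r < 1 -> f 0 = 0 ->
  {within [set t : R | 0 <= t], continuous f} ->
  (forall j l, (l < 2 ^ j)%N ->
    `|f (l.+1%:R * (h / 2 ^+ j)) - f (l%:R * (h / 2 ^+ j))| <= g * r ^+ j) ->
  forall t, 0 <= t -> t <= h -> `|f t| <= g / (1 - r).
Proof.
move=> h0 g0 r0 r1 f0 cf incr t t0 th.
have grid J l : (l <= 2 ^ J)%N -> `|f (l%:R * (h / 2 ^+ J))| <= g / (1 - r).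
  move=> lJ; apply: (le_trans (dyadic_chaining f h (fun j => g * r ^+ j) f0 _ incr J l lJ)).
    by move=> j; rewrite mulr_ge0 ?exprn_ge0.
  by rewrite -mulr_sumr ler_wpM2l// geometric_sum_le.
apply/ler_addgt0Pr => e e0.
have : f @ within [set t : R | 0 <= t] (nbhs t) --> f t.
  have := cf t; rewrite /continuous_at.
  by rewrite nbhs_subspace_in.
move=> /cvgrPdist_lt /(_ e e0); rewrite near_withinE => /nbhs_ballP[d /= d0 hd].
have [J hJ] : exists J : nat, h / 2 ^+ J < d.
  have [n hn] : exists n : nat, h / d < n%:R.
    by exists (Num.truncn (h / d)).+1; rewrite truncnS_gt.
  exists n; rewrite ltr_pdivrMr ?exprn_gt0// mulrC -ltr_pdivrMr//.
  by rewrite (lt_le_trans hn)// -natrX ler_nat ltnW// ltn_expl.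
set u := h / 2 ^+ J in hJ.
have u0 : 0 < u by rewrite divr_gt0 ?exprn_gt0.
(* The grid point just left of t: it stays in the half-line where [f] is continuous, and its index
   is at most 2^J. *)
set l := Num.truncn (t / u).
have [l1 l2] : l%:R * u <= t /\ t < l.+1%:R * u.
  have /truncn_itv/andP[] : 0 <= t / u by rewrite divr_ge0 ?(ltW u0).
  by rewrite ler_pdivlMr// ltr_pdivrMr.
have lJ : (l <= 2 ^ J)%N.
  rewrite -(ler_nat R) natrX -(ler_pM2r u0) (le_trans l1)// (le_trans th)//.
  by rewrite /u mulrC divfK// expf_neq0.
have /hd : ball t d (l%:R * u).
  rewrite /ball/= ger0_norm ?subr_ge0// (le_lt_trans _ hJ)//.
  by rewrite lerBlDl; move: l2; rewrite mulrSr mulrDl mul1r => /ltW.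
move=> /(_ _)/ltW hft.
rewrite -[f t](subrK (f (l%:R * u))) addrC (le_trans (ler_normD _ _))// lerD//.
  exact: grid.
by apply: hft; rewrite /= mulr_ge0// ltW.
Qed.

End Chaining.

Section DyadicScale.
Variable R : realType.

Lemma dyadic_scale (t : R) : 1 <= t -> exists k, 2 ^+ k <= t < 2 ^+ k.+1.
Proof.
move=> t1; have ex : exists k, t < 2 ^+ k.
  exists (Num.truncn t).+1; apply: (lt_trans (truncnS_gt t)).
  by rewrite -natrX ltr_nat ltn_expl.
have tk := ex_minnP ex; case: tk => -[|k] htk mk.
  by move: htk; rewrite expr0 ltNge t1.
exists k; rewrite htk andbT leNgt; apply/negP => /mk.
by rewrite ltnn.
Qed.

(* This is r = 2^(-1/4). An increment of variance v at scale k and level j is compared with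
   sqrt (2^((k+j)/2) v): large enough for the Gaussian tails to be summable over all dyadic
   intervals, small enough to decay like r^j along a chain. *)
Definition quarter_ratio : R := Num.sqrt (Num.sqrt 2 / 2).
Notation r := quarter_ratio.

Lemma quarter_ratio_sqr : r ^+ 2 = Num.sqrt 2 / 2.
Proof. by rewrite sqr_sqrtr// divr_ge0. Qed.

Lemma quarter_ratio_pow4 : r ^+ 4 = 2^-1.
Proof.
by rewrite (exprM _ 2 2) quarter_ratio_sqr expr_div_n sqr_sqrtr//; field.
Qed.

Lemma quarter_ratio_gt0 : 0 < r.
Proof. by rewrite sqrtr_gt0 divr_gt0 ?sqrtr_gt0. Qed.

Lemma quarter_ratio_lt1 : r < 1.
Proof.
rewrite -(@ltr_pXn2r _ 4%N)// ?nnegrE ?(ltW quarter_ratio_gt0)//.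
by rewrite quarter_ratio_pow4 expr1n invf_lt1// ltr1n.
Qed.

(** The variance is parametrised by x so that x = 2^k covers base intervals of length 2^k and x = 1
    those of length 2^-k. *)
Lemma sqrt_scale_le (x : R) (k j : nat) : 0 <= x ->
  Num.sqrt (Num.sqrt 2 ^+ (k + j) * (x ^+ 2 * 2 ^- k / 2 ^+ j)) =
  x * r ^+ k * r ^+ j.
Proof.
move=> x0.
have -> : Num.sqrt 2 ^+ (k + j) * (x ^+ 2 * 2 ^- k / 2 ^+ j) =
    (x * r ^+ k * r ^+ j) ^+ 2 :> R.
  rewrite !exprMn ![(r ^+ _) ^+ 2]exprAC !quarter_ratio_sqr !expr_div_n exprD.
  by field; rewrite !expf_neq0.
by rewrite sqrtr_sqr ger0_norm// !mulr_ge0// exprn_ge0// ltW// quarter_ratio_gt0.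
Qed.

Lemma powR_quarter_pow4 (x : R) : 0 <= x -> (x ^+ 4) `^ (4^-1) = x.
Proof. by move=> x0; rewrite -powR_mulrn// -powRrM divff// powRr1. Qed.

End DyadicScale.

(** * Growth of Brownian paths at infinity and at the origin *)

Section BrownianBounds.
Context {R : realType} {d : measure_display} {T : measurableType d}.
Variable Pr : probability T R.

Lemma measure_bigsetU_le (I : Type) (s : seq I) (F : I -> set T) (c : I -> R) :
  (forall i, measurable (F i)) -> (forall i, (Pr (F i) <= (c i)%:E)%E) ->
  (Pr (\big[setU/set0]_(i <- s) F i) <= (\sum_(i <- s) c i)%:E)%E.
Proof.
move=> mF cF; elim: s => [|i s IH]; first by rewrite !big_nil measure0.
rewrite !big_cons EFinD; apply: le_trans (leeD (cF i) IH).
by apply: measureU2 => //; exact: bigsetU_measurable.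
Qed.

(** Scaling the threshold by the variance makes the bound independent of v, so that a single
    estimate handles dyadic intervals of all lengths. *)
Lemma centered_normal_tail (X : T -> R) (v y : R) : 0 < v -> 0 < y ->
  centered_normal Pr v X ->
  (Pr [set om | (Num.sqrt (y * v) < `|X om|)%R] <=
   (Num.sqrt 2 * (16 / y) ^+ 4)%:E)%E.
Proof.
move=> v0 y0 hX; set a := Num.sqrt (y * v).
have mV : measurable [set x : R | a < `|x|].
  have -> : [set x : R | a < `|x|] = (Num.norm : R -> R) @^-1` `]a, +oo[%classic.
    by apply/seteqP; split => x /=; rewrite in_itv/= andbT.
  by rewrite -[X in measurable X]setTI; exact: normr_measurable.
have := hX _ mV; rewrite /preimage/= => ->.
apply: (le_trans (normal_prob_tail _ _ _ _ _)).
- by rewrite sqrtr_gt0.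
- exact: sqrtr_ge0.
rewrite lee_fin ler_wpM2l// /a !sqr_sqrtr ?(ltW v0) ?mulr_ge0 ?(ltW y0) ?(ltW v0)//.
have -> : y * v / (4 * v) = y / 4 by field; rewrite gt_eqF.
have -> : 16 / y = 4 / (y / 4) by field; rewrite gt_eqF.
by apply: expRN_le_pow4; rewrite divr_gt0.
Qed.

Variable X : R -> T -> R.
Hypothesis mX : forall t, 0 <= t -> measurable_fun setT (X t).
Hypothesis incrX : forall s t, 0 <= s -> s < t ->
  centered_normal Pr (t - s) (fun om => X t om - X s om).

(** Borel-Cantelli over scales and levels at once. The base lengths [h k] are arbitrary because the
    probability of a bad increment depends only on k + j. *)
Lemma dyadic_increments_as_le (h : nat -> R) : (forall k, 0 < h k) ->
  {ae Pr, forall om, exists M, forall k, (M <= k)%N -> forall j l, (l < 2 ^ j)%N ->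
    `|X (l.+1%:R * (h k / 2 ^+ j)) om - X (l%:R * (h k / 2 ^+ j)) om| <=
    Num.sqrt (Num.sqrt 2 ^+ (k + j) * (h k / 2 ^+ j))}.
Proof.
move=> h0.
pose q k j := h k / 2 ^+ j.
have q0 k j : 0 < q k j by rewrite divr_gt0 ?exprn_gt0.
pose bad k j l := [set om | Num.sqrt (Num.sqrt 2 ^+ (k + j) * q k j) <
  `|X (l.+1%:R * q k j) om - X (l%:R * q k j) om|].
have mbad k j l : measurable (bad k j l).
  have mD : measurable_fun setT (fun om => X (l.+1%:R * q k j) om - X (l%:R * q k j) om).
    by apply: measurable_funB; apply: mX; rewrite mulr_ge0// ltW.
  have mN : measurable_fun setT
      (fun om => `|X (l.+1%:R * q k j) om - X (l%:R * q k j) om|).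
    exact: measurableT_comp.
  rewrite -[X in measurable X]setTI.
  have := mN measurableT `]Num.sqrt (Num.sqrt 2 ^+ (k + j) * q k j), +oo[%classic
    (measurable_itv _).
  congr (measurable (_ `&` _)).
  by apply/seteqP; split => x /=; rewrite in_itv/= andbT.
pose C : R := Num.sqrt 2 * 16 ^+ 4.
have Pbad k j l : (Pr (bad k j l) <= (C / 4 ^+ (k + j))%:E)%E.
  have hc : centered_normal Pr (q k j)
     (fun om => X (l.+1%:R * q k j) om - X (l%:R * q k j) om).
    have e : l.+1%:R * q k j - l%:R * q k j = q k j.
      by rewrite -mulrBl -natrB// subSnn mul1r.
    have := incrX (l%:R * q k j) (l.+1%:R * q k j); rewrite e; apply.
      by rewrite mulr_ge0// ltW.
    by rewrite ltr_pM2r// ltr_nat.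
  have s0 : 0 < Num.sqrt 2 ^+ (k + j) :> R by rewrite exprn_gt0 ?sqrtr_gt0.
  apply: (le_trans (centered_normal_tail _ _ _ (q0 k j) s0 hc)).
  rewrite lee_fin /C -mulrA ler_wpM2l// expr_div_n -exprM mulnC exprM.
  have -> : Num.sqrt 2 ^+ 4 = 4 :> R.
    by rewrite (exprM _ 2 2) sqr_sqrtr// -natrX.
  by [].
(* Pairs (k, j) are grouped by m = k + j, which makes the doubly indexed bad events a single
   sequence; avoiding [F m] for all m >= M controls every level j at every scale k >= M. *)
pose F m := \big[setU/set0]_(j < m.+1) \big[setU/set0]_(l < 2 ^ j) bad (m - j)%N j l.
have mF m : measurable (F m).
  by apply: bigsetU_measurable => j _; apply: bigsetU_measurable => l _.
(* Level j has 2^j intervals, each bad with probability at most C / 4^m, and the powers 2^j with j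
   <= m sum to less than 2^(m+1). The bound is written over 2^(m+1) so that its series sums to 4
   C. *)
have PF m : (Pr (F m) <= ((4 * C) / (2 ^ m.+1)%:R)%:E)%E.
  apply: (le_trans (measure_bigsetU_le 'I_m.+1 _ _ (fun j => 2 ^+ j * (C / 4 ^+ m)) _ _)).
  - by move=> j; apply: bigsetU_measurable => l _.
  - move=> j; apply: (le_trans (measure_bigsetU_le 'I_(2 ^ j) _ _ (fun=> C / 4 ^+ m) _ _)) => //.
      move=> l; have := Pbad (m - j)%N j l.
      by rewrite subnK// -ltnS.
    by rewrite lee_fin sumr_const card_ord -[leLHS]mulr_natl natrX.
  rewrite lee_fin -mulr_suml.
  have -> : \sum_(j < m.+1) 2 ^+ j = 2 ^+ m.+1 - 1 :> R.
    by rewrite subrX1 -[2 - 1]/(1 + 1 - 1) addrK mul1r.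
  have C0 : 0 <= C by rewrite mulr_ge0// exprn_ge0.
  rewrite natrX exprS.
  have -> : 4 * C / (2 * 2 ^+ m) = 2 * 2 ^+ m * (C / 4 ^+ m).
    have -> : 4 ^+ m = 2 ^+ m * 2 ^+ m :> R by rewrite -exprMn -natrM.
    by field; rewrite expf_neq0.
  rewrite ler_wpM2r// ?gerBl//.
  by rewrite divr_ge0// exprn_ge0.
have : Pr (lim_sup_set F) = 0%E.
  apply: lim_sup_set_cvg0 => //.
  apply: (@le_lt_trans _ _ (\sum_(m <oo) ((4 * C) / (2 ^ m.+1)%:R)%:E)%E).
    by apply: lee_nneseries => // m _; exact: PF.
  apply: le_lt_trans (ltry (4 * C)).
  by apply: epsilon_trick0; rewrite !mulr_ge0// exprn_ge0.
move=> P0; exists (lim_sup_set F); split => //.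
  apply: bigcapT_measurable => m.
  by apply: bigcup_measurable => k _.
move=> om /= hom; apply: contrapT => nl; apply: hom.
have [M hM] : exists M, forall m, (M <= m)%N -> ~ F m om.
  move: nl; rewrite /lim_sup_set /bigcap/= => /existsNP[M /not_implyP[_ hM]].
  by exists M => m Mm Fm; apply: hM; exists m.
exists M => k Mk j l lj; rewrite leNgt; apply/negP => hb.
apply: (hM (k + j)%N); first by rewrite (leq_trans Mk)// leq_addr.
rewrite /F -(bigcup_mkord _
  (fun i => \big[setU/set0]_(l < 2 ^ i) bad (k + j - i)%N i l)).
exists j => /=; first by rewrite ltnS leq_addl.
by rewrite -(bigcup_mkord _ (fun l => bad (k + j - j)%N j l)); exists l; rewrite ?addnK.
Qed.

(** Chaining on [0, 2^k] gives a bound of order 2^k r^k = 2^(3k/4), that is |X t| = O(t^(3/4)). The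
    start at 0 and continuity are assumed path by path because they hold only outside a null set. *)
Lemma brownian_growth_as : {ae Pr, forall om,
  X 0 om = 0 -> {within [set t : R | 0 <= t], continuous (X^~ om)} ->
  (fun t => t^-1 * X t om) @ +oo --> 0}.
Proof.
pose r := quarter_ratio R.
have r0 : 0 < r := quarter_ratio_gt0 R.
have r1 : r < 1 := quarter_ratio_lt1 R.
have h0 k : 0 < 2 ^+ k :> R by rewrite exprn_gt0.
have := dyadic_increments_as_le _ h0; apply: filterS => om [M hM] X0 cX.
have bnd k t : (M <= k)%N -> 0 <= t -> t <= 2 ^+ k ->
    `|X t om| <= 2 ^+ k * r ^+ k / (1 - r).
  move=> Mk; apply: (chaining_bound R (X^~ om)) => //.
  - by rewrite mulr_ge0 ?exprn_ge0// ltW.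
  - exact: ltW.
  move=> j l lj; apply: (le_trans (hM k Mk j l lj)).
  rewrite -sqrt_scale_le ?exprn_ge0//.
  by rewrite [_ ^+ k ^+ 2]expr2 mulfK// expf_neq0.
pose c := 2 / (1 - r).
have c0 : 0 < c by rewrite divr_gt0// subr_gt0.
(* Fourth powers replace t^(-1/4) by a rational expression, as r^4 = 1/2. The 2 in [c] comes from
   bounding t in [2^k, 2^(k+1)) by the estimate for the larger endpoint. *)
have key t : 1 <= t -> 2 ^+ M <= t -> (`|t^-1 * X t om|) ^+ 4 <= c ^+ 4 / t.
  move=> t1 tM; have [k /andP[kt tk]] := dyadic_scale _ _ t1.
  have t0 : 0 < t by rewrite (lt_le_trans ltr01).
  have Mk : (M <= k.+1)%N.
    rewrite -(@ler_eXn2l R 2)// ?ltr1n//.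
    by rewrite (le_trans tM)// ltW.
  have hb := bnd _ _ Mk (ltW t0) (ltW tk).
  have cr0 : 0 <= c * r ^+ k.+1.
    by apply: mulr_ge0; [exact: ltW | rewrite exprn_ge0// ltW].
  apply: (@le_trans _ _ ((c * r ^+ k.+1) ^+ 4)).
    rewrite ler_pXn2r// ?nnegrE//.
    rewrite normrM normfV (gtr0_norm t0) mulrC ler_pdivrMr//.
    apply: (le_trans hb).
    have -> : 2 ^+ k.+1 * r ^+ k.+1 / (1 - r) = c * r ^+ k.+1 * 2 ^+ k.
      by rewrite /c exprS; field; rewrite gt_eqF// subr_gt0.
    exact: ler_wpM2l.
  rewrite exprMn -exprM mulnC exprM quarter_ratio_pow4.
  rewrite ler_wpM2l ?exprn_ge0 ?(ltW c0)// exprVn lef_pV2 ?posrE ?exprn_gt0//.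
  exact: ltW.
apply/cvgrPdist_lt => e e0; near=> t.
rewrite sub0r normrN -(@ltr_pXn2r _ 4%N)// ?nnegrE ?(ltW e0)//.
have t1 : 1 <= t by near: t; exact: nbhs_pinfty_ge.
have t0 : 0 < t by rewrite (lt_le_trans ltr01).
have tM : 2 ^+ M <= t by near: t; apply: nbhs_pinfty_ge; rewrite num_real.
have te : c ^+ 4 / e ^+ 4 < t by near: t; apply: nbhs_pinfty_gt; rewrite num_real.
apply: (le_lt_trans (key _ t1 tM)).
by rewrite ltr_pdivrMr// mulrC -ltr_pdivrMr// exprn_gt0.
Unshelve. all: by end_near. Qed.

(** The same chaining on [0, 2^-k] gives r^k = (2^-k)^(1/4). With k chosen so that t <= 2^-k <= 2 t,
    this is at most (2 t)^(1/4), whence the factor 2^(1/4). *)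
Lemma brownian_small_time_as : {ae Pr, forall om,
  X 0 om = 0 -> {within [set t : R | 0 <= t], continuous (X^~ om)} ->
  exists C D : R, [/\ 0 <= C, 0 < D &
    forall t, 0 < t -> t <= D -> `|X t om| <= C * t `^ (4^-1)]}.
Proof.
pose r := quarter_ratio R.
have r0 : 0 < r := quarter_ratio_gt0 R.
have r1 : r < 1 := quarter_ratio_lt1 R.
have h0 k : 0 < 2 ^- k :> R by rewrite invr_gt0 exprn_gt0.
have := dyadic_increments_as_le _ h0; apply: filterS => om [M hM] X0 cX.
have bnd k t : (M <= k)%N -> 0 <= t -> t <= 2 ^- k ->
    `|X t om| <= r ^+ k / (1 - r).
  move=> Mk; apply: (chaining_bound R (X^~ om)) => //.
  - by rewrite exprn_ge0// ltW.
  - exact: ltW.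
  move=> j l lj; apply: (le_trans (hM k Mk j l lj)).
  by rewrite -[r ^+ k]mul1r -sqrt_scale_le// expr1n mul1r.
have c0 : 0 <= (1 - r)^-1 by rewrite invr_ge0 subr_ge0 ltW.
exists (2 `^ 4^-1 / (1 - r)), (2 ^- M); split => //.
  by rewrite mulr_ge0 ?powR_ge0.
move=> t t0 tM.
have t1 : 1 <= t^-1.
  rewrite invf_ge1//; apply: (le_trans tM).
  by rewrite invf_le1 ?exprn_gt0// exprn_ege1// ler1n.
have [k /andP[kt tk]] := dyadic_scale _ _ t1.
have Mk : (M <= k)%N.
  rewrite -ltnS -(@ltr_eXn2l R 2)// ?ltr1n//.
  rewrite (le_lt_trans _ tk)// -[2 ^+ M]invrK lef_pV2// posrE//.
have tk' : t <= 2 ^- k by rewrite -[t]invrK lef_pV2// posrE ?invr_gt0 ?exprn_gt0.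
apply: (le_trans (bnd _ _ Mk (ltW t0) tk')).
rewrite mulrAC ler_wpM2r// -powRM// ?(ltW t0)//.
rewrite -[leLHS]powR_quarter_pow4 ?exprn_ge0 ?(ltW r0)//.
apply: ge0_ler_powR.
- by [].
- by rewrite nnegrE exprn_ge0 ?exprn_ge0 ?(ltW r0).
- by rewrite nnegrE mulr_ge0// ltW.
rewrite -exprM mulnC exprM quarter_ratio_pow4 exprVn.
rewrite -ler_pdivrMl// -invfM -exprS -[leRHS]invrK lef_pV2 ?posrE ?invr_gt0 ?exprn_gt0//.
exact: ltW.
Qed.

End BrownianBounds.

(** * Quadratic forms and barriers *)

Section PointwiseSums.
Context {R : realType}.

Lemma cvg_sumr (T : Type) (F : set_system T) (FF : Filter F) (I : Type)
    (s : seq I) (f : I -> T -> R) (l : I -> R) :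
  (forall i, f i x @[x --> F] --> l i) ->
  (\sum_(i <- s) f i x) @[x --> F] --> \sum_(i <- s) l i.
Proof.
move=> fl; elim: s => [|i s IH].
  by rewrite big_nil; under eq_fun do rewrite big_nil; exact: cvg_cst.
rewrite big_cons; under eq_fun do rewrite big_cons.
exact: cvgD.
Qed.

Lemma is_derive_sumr (I : Type) (s : seq I) (f : I -> R -> R) (df : I -> R) (t : R) :
  (forall i, is_derive t 1 (f i) (df i)) ->
  is_derive t 1 (fun u => \sum_(i <- s) f i u) (\sum_(i <- s) df i).
Proof.
move=> fl; elim: s => [|i s IH].
  by rewrite big_nil; under eq_fun do rewrite big_nil; exact: is_derive_cst.
rewrite big_cons; under eq_fun do rewrite big_cons.
exact: is_deriveD.
Qed.

End PointwiseSums.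

Section QuadraticForms.
Context {R : realType} {n : nat}.
Implicit Types (M W : 'M[R]_n) (x y : 'cV[R]_n).

Definition qf M x : R := (x^T *m M *m x) 0 0.
Definition sqn x : R := \sum_i x i 0 ^+ 2.
Definition mx_sum_abs M : R := \sum_i \sum_j `|M i j|.

Lemma qfE M x : qf M x = \sum_i \sum_j x i 0 * x j 0 * M i j.
Proof.
rewrite /qf mxE exchange_big/=; apply: eq_bigr => j _.
rewrite mxE mulr_suml; apply: eq_bigr => i _.
by rewrite mxE mulrAC.
Qed.

Lemma qfD M W x : qf (M + W) x = qf M x + qf W x.
Proof. by rewrite /qf mulmxDr mulmxDl mxE. Qed.

Lemma qfN M x : qf (- M) x = - qf M x.
Proof. by rewrite /qf mulmxN mulNmx mxE. Qed.

Lemma qfB M W x : qf (M - W) x = qf M x - qf W x.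
Proof. by rewrite qfD qfN. Qed.

Lemma qfZ (a : R) M x : qf (a *: M) x = a * qf M x.
Proof. by rewrite /qf -scalemxAr -scalemxAl mxE. Qed.

Lemma sqn_ge0 x : 0 <= sqn x.
Proof. by apply: sumr_ge0 => i _; exact: sqr_ge0. Qed.

Lemma sqn_eq0 x : sqn x = 0 -> x = 0.
Proof.
move/eqP; rewrite psumr_eq0 => [/allP h|i _]; last exact: sqr_ge0.
apply/matrixP => i j; rewrite ord1 mxE.
by apply/eqP; rewrite -sqrf_eq0; apply: h; rewrite mem_index_enum.
Qed.

Lemma sqn_gt0 x : x != 0 -> 0 < sqn x.
Proof.
by move=> x0; rewrite lt_neqAle sqn_ge0 andbT eq_sym; apply: contra_neq x0 => /sqn_eq0.
Qed.

Lemma sqnE x : sqn x = (x^T *m x) 0 0.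
Proof. by rewrite mxE; apply: eq_bigr => i _; rewrite mxE. Qed.

Lemma mx_sum_abs_ge0 M : 0 <= mx_sum_abs M.
Proof. by apply: sumr_ge0 => i _; exact: sumr_ge0. Qed.

Lemma qf_abs_le M x : `|qf M x| <= mx_sum_abs M * sqn x.
Proof.
have xi i : x i 0 ^+ 2 <= sqn x.
  by rewrite /sqn (bigD1 i)//= lerDl sumr_ge0// => k _; exact: sqr_ge0.
rewrite qfE mulr_suml (le_trans (ler_norm_sum _ _ _))//; apply: ler_sum => i _.
rewrite mulr_suml (le_trans (ler_norm_sum _ _ _))//; apply: ler_sum => j _.
rewrite normrM mulrC ler_wpM2l// ler_norml.
have := xi i; have := xi j.
have := sqr_ge0 (x i 0 - x j 0); have := sqr_ge0 (x i 0 + x j 0).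
by rewrite sqrrB sqrrD; lra.
Qed.

(** Along the line x + s W x the form equals 2 s |W x|^2 + s^2 q(W x), which is negative for small s
    < 0 unless W x = 0. *)
Lemma possemidef_kernel W x : possemidef W -> qf W x = 0 -> W *m x = 0.
Proof.
move=> [sW pW] q0; set y := W *m x.
have expand s : qf W (x + s *: y) = 2 * s * sqn y + s ^+ 2 * qf W y.
  have -> : qf W (x + s *: y) =
      qf W x + s * (x^T *m W *m y) 0 0 + s * (y^T *m W *m x) 0 0 + s ^+ 2 * qf W y.
    have -> : qf W (x + s *: y) = ((x^T + s *: y^T) *m W *m (x + s *: y)) 0 0.
      by rewrite /qf; congr ((_ *m W *m _) 0 0); rewrite linearD/= linearZ.
    rewrite !(mulmxDl, mulmxDr) -!(scalemxAl, scalemxAr).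
    have addE (a b : 'M[R]_1) : (a + b) 0 0 = a 0 0 + b 0 0 by rewrite mxE.
    have scaleE k (a : 'M[R]_1) : (k *: a) 0 0 = k * a 0 0 by rewrite mxE.
    by rewrite !addE !scaleE /qf; ring.
  have -> : x^T *m W = y^T by rewrite /y trmx_mul sW.
  by rewrite -(mulmxA y^T) -/y -sqnE q0; ring.
apply: sqn_eq0; apply/eqP; rewrite eq_le sqn_ge0 andbT.
have b0 : 0 <= qf W y := pW y.
have c0 : 0 < qf W y + 1 by rewrite ltr_wpDl.
(* The minimiser over s would be - |y|^2 / q(y); adding 1 to the denominator keeps it positive when
   q(y) = 0 and still gives a negative value. *)
have := pW (x + (- (sqn y / (qf W y + 1))) *: y).
rewrite -/(qf _ _) expand => h.
have {}h : 0 <= (qf W y + 1) ^+ 2 *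
   (2 * - (sqn y / (qf W y + 1)) * sqn y + (- (sqn y / (qf W y + 1))) ^+ 2 * qf W y).
  by rewrite mulr_ge0// exprn_ge0// ltW.
have e : (qf W y + 1) ^+ 2 *
   (2 * - (sqn y / (qf W y + 1)) * sqn y + (- (sqn y / (qf W y + 1))) ^+ 2 * qf W y)
   = - (sqn y ^+ 2 * (qf W y + 2)).
  by field; rewrite gt_eqF.
rewrite e oppr_ge0 in h.
rewrite leNgt; apply/negP => s0.
have : 0 < sqn y ^+ 2 * (qf W y + 2).
  by rewrite mulr_gt0 ?exprn_gt0// ltr_wpDl.
by rewrite ltNge h.
Qed.

Lemma posdef_semi W : posdef W -> possemidef W.
Proof.
move=> [sW pW]; split => // x; have [->|/pW/ltW//] := eqVneq x 0.
by rewrite mulmx0 mxE.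
Qed.

(** Polarization, by which bounds on quadratic forms become bounds on entries at the end of the
    convergence proof. *)
Lemma qf_polar W i j : W^T = W ->
  let x : 'cV[R]_n := delta_mx i 0 in let y : 'cV[R]_n := delta_mx j 0 in
  2 * W i j = qf W (x + y) - qf W x - qf W y.
Proof.
move=> sW x y.
have dd k l : ((delta_mx k 0 : 'cV[R]_n)^T *m W *m (delta_mx l 0 : 'cV[R]_n)) 0 0 = W k l.
  by rewrite trmx_delta -rowE -colE !mxE.
have sij : W j i = W i j by rewrite -{1}sW mxE.
have -> : qf W (x + y) = ((x^T + y^T) *m W *m (x + y)) 0 0.
  by rewrite /qf; congr ((_ *m W *m _) 0 0); rewrite linearD.
rewrite /qf !(mulmxDl, mulmxDr).
have addE (a b : 'M[R]_1) : (a + b) 0 0 = a 0 0 + b 0 0 by rewrite mxE.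
by rewrite !addE !dd sij; ring.
Qed.

End QuadraticForms.

Section Coercivity.
Context {R : realType}.

(** The constant is the minimum of the form on the compact unit sphere. *)
Lemma posdef_coercive n (M : 'M[R]_n) : posdef M ->
  exists2 c : R, 0 < c & forall x, c * sqn x <= qf M x.
Proof.
(* In dimension 0 the sphere is empty and any constant works. *)
case: n M => [|n] M [sM pM].
  by exists 1 => // x; rewrite /sqn big_ord0 mulr0 qfE big_ord0.
pose S : set 'rV[R]_n.+1 := [set v | \sum_i v 0 i ^+ 2 = 1].
have coordc (i : 'I_n.+1) : continuous (fun v : 'rV[R]_n.+1 => v 0 i).
  exact: coord_continuous.
have cS : compact S.
  apply: bounded_closed_compact.
    exists 1; split => // y y1 v /= Sv.
    rewrite (le_trans _ (ltW y1))// [leLHS]/Num.norm/= mx_normrE.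
    apply/bigmax_leP; split => // -[i j] _ /=; rewrite ord1.
    rewrite -(@ler_pXn2r _ 2%N)// ?nnegrE// real_normK ?num_real// expr1n -Sv.
    by rewrite (bigD1 j)//= lerDl sumr_ge0// => k _; exact: sqr_ge0.
  rewrite (_ : S = (fun v : 'rV[R]_n.+1 => \sum_i v 0 i ^+ 2) @^-1` [set 1])//.
  apply: closed_comp; last exact: closed_eq.
  move=> v _; apply: (cvg_sumr _ (nbhs v) _) => i.
  by apply: cvgM; exact: coordc.
have cf : continuous (fun v : 'rV[R]_n.+1 => qf M v^T).
  move=> v.
  rewrite (_ : (fun v => _) = fun v : 'rV[R]_n.+1 =>
      \sum_i \sum_j v 0 i * v 0 j * M i j); last first.
    apply/funext => u; rewrite qfE; apply: eq_bigr => i _.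
    by apply: eq_bigr => j _; rewrite !mxE.
  apply: (cvg_sumr _ (nbhs v) _) => i; apply: (cvg_sumr _ (nbhs v) _) => j.
  apply: cvgMr_tmp; apply: cvgM; exact: coordc.
have S0 : S !=set0.
  exists (delta_mx 0 0); rewrite /S/= (bigD1 0)//= big1 ?addr0.
    by rewrite mxE eqxx expr1n.
  by move=> i i0; rewrite mxE (negbTE i0) expr0n.
have [v vS vmin] := compact_EVT_min S0 cS (continuous_subspaceT cf).
have sv : sqn v^T = 1.
  by move: vS; rewrite inE /S/= => <-; apply: eq_bigr => i _; rewrite mxE.
have v0 : v^T != 0.
  apply/eqP => v0; move: sv; rewrite v0 /sqn big1 => [/esym/eqP|i _].
    by rewrite oner_eq0.
  by rewrite mxE expr0n.
exists (qf M v^T); first exact: pM.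
move=> x; have [->|x0] := eqVneq x 0.
  have -> : qf M 0 = 0 by rewrite /qf mulmx0 mxE.
  by rewrite /sqn big1 ?mulr0// => i _; rewrite mxE expr0n.
have s0 := sqn_gt0 _ x0.
pose a := Num.sqrt (sqn x).
have a0 : 0 < a by rewrite sqrtr_gt0.
have a2 : a ^+ 2 = sqn x by rewrite sqr_sqrtr// ltW.
have : (a^-1 *: x^T) \in S.
  rewrite inE /S/=; under eq_bigr do rewrite !mxE exprMn.
  by rewrite -mulr_sumr -/(sqn x) exprVn a2 mulVf// gt_eqF.
move=> /vmin; rewrite linearZ/= trmxK.
have -> : qf M (a^-1 *: x) = qf M x / sqn x.
  have -> : qf M (a^-1 *: x) = ((a^-1 *: x^T) *m M *m (a^-1 *: x)) 0 0.
    by rewrite /qf; congr ((_ *m M *m _) 0 0); rewrite linearZ.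
  rewrite -!(scalemxAl, scalemxAr) mxE [X in _ * X]mxE -/(qf M x) -a2.
  by field; rewrite gt_eqF.
by rewrite ler_pdivlMr.
Qed.

End Coercivity.

(** * First-exit argument for positive definiteness *)

Section Barrier.
Context {R : realType}.

Lemma is_derive_continuous (g : R -> R) (t l : R) : is_derive t 1 g l ->
  g s @[s --> t] --> g t.
Proof.
by move=> dg; apply/differentiable_continuous/derivable1_diffP; exact: ex_derive.
Qed.

Lemma is_derive_gt0_left (g : R -> R) (t l : R) : is_derive t 1 g l -> 0 < l ->
  \forall s \near t^'-, g s < g t.
Proof.
move=> dg l0.
have q : h^-1 *: (g (h *: 1 + t) - g t) @[h --> 0^'] --> l.
  by rewrite -[l in X in _ --> X](@derive_val _ _ _ _ _ _ _ dg); exact: (@ex_derive _ _ _ _ _ _ _ dg).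
have /nbhs_ballP[e /= e0 he] : \forall h \near 0^', 0 < h^-1 *: (g (h *: 1 + t) - g t).
  exact: (cvgr_gt _ q).
near=> s.
have st : s < t by near: s; exact: nbhs_left_lt.
have ts : t - s < e by near: s; exact: nbhs_left_ltBl.
have /he : ball 0 e (s - t).
  by rewrite /ball/= sub0r normrN distrC ger0_norm// subr_ge0 ltW.
have st0 : s - t != 0 by rewrite subr_eq0 lt_eqF.
move=> /(_ st0); rewrite scaler1 subrK /GRing.scale/=.
by rewrite nmulr_rgt0 ?invr_lt0 ?subr_lt0.
Unshelve. all: by end_near. Qed.

Lemma is_derive_qf n (W : R -> 'M[R]_n) (dW : 'M[R]_n) (t : R) (x : 'cV[R]_n) :
  (forall i j, is_derive t 1 (fun s => W s i j) (dW i j)) ->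
  is_derive t 1 (fun s => qf (W s) x) (qf dW x).
Proof.
move=> dWij.
have -> : (fun s => qf (W s) x) =
    fun s => \sum_i \sum_j x i 0 * x j 0 * W s i j.
  by apply/funext => s; rewrite qfE.
by rewrite qfE; apply: is_derive_sumr => i; apply: is_derive_sumr => j.
Qed.

(** Uniformity in x is the point. The filter is general because the lemma serves at 0+, at interior
    times and at infinity. *)
Lemma qf_cvg_near n (F : set_system R) {FF : Filter F} (W : R -> 'M[R]_n)
    (L : 'M[R]_n) (e : R) : 0 < e ->
  (forall i j, W s i j @[s --> F] --> L i j) ->
  \forall s \near F, forall x, `|qf (W s) x - qf L x| <= e * sqn x.
Proof.
move=> e0 WL.
have h : mx_sum_abs (W s - L) @[s --> F] --> 0.
  have -> : 0 = \sum_(i < n) \sum_(j < n) `|L i j - L i j| :> R.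
    by rewrite big1// => i _; rewrite big1// => j _; rewrite subrr normr0.
  rewrite /mx_sum_abs.
  apply: (cvg_sumr _ F _) => i; apply: (cvg_sumr _ F _) => j.
  under eq_fun do rewrite !mxE.
  by apply: cvg_norm; apply: cvgB; [exact: WL|exact: cvg_cst].
have : \forall s \near F, mx_sum_abs (W s - L) < e by exact: (cvgr_lt _ h).
apply: filterS => s hs x; rewrite -qfB (le_trans (qf_abs_le _ _))//.
by rewrite ler_wpM2r ?sqn_ge0// ltW.
Qed.

(** Positive definiteness is open among symmetric matrices; symmetry is not an open condition, so it
    remains a premise at each nearby time. *)
Lemma posdef_near n (F : set_system R) {FF : Filter F} (W : R -> 'M[R]_n)
    (L : 'M[R]_n) : posdef L ->
  (forall i j, W s i j @[s --> F] --> L i j) ->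
  \forall s \near F, (W s)^T = W s -> posdef (W s).
Proof.
move=> pL WL; have [c c0 hc] := posdef_coercive _ _ pL.
have c2 : 0 < c / 2 by rewrite divr_gt0.
apply: (filterS _ (qf_cvg_near _ F W L _ c2 WL)) => s hs sW; split => // x x0.
rewrite -/(qf _ _); have := hs x; rewrite ler_distl => /andP[+ _].
apply: lt_le_trans; have := hc x; have := sqn_gt0 _ x0.
have : 0 < c / 2 * sqn x by rewrite mulr_gt0// sqn_gt0.
by lra.
Qed.

(* At the first time W ceases to be positive definite it is semidefinite with a kernel vector x,
   and x^T W x would reach 0 from above with a positive derivative. *)
Lemma posdef_barrier n (W dW : R -> 'M[R]_n) (a : R) :
  (forall t, a <= t -> (W t)^T = W t) ->
  (forall t, a <= t -> forall i j, is_derive t 1 (fun s => W s i j) (dW t i j)) ->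
  posdef (W a) ->
  (forall t x, a < t -> x != 0 -> possemidef (W t) -> W t *m x = 0 -> 0 < qf (dW t) x) ->
  forall t, a <= t -> posdef (W t).
Proof.
move=> sW dWij pa inward t2 at2; apply: contrapT => np2.
pose S := [set t | a <= t /\ ~ posdef (W t)].
have S2 : S t2 by [].
have lbS : lbound S a by move=> t [].
have infS : has_inf S by split; [exists t2 | exists a].
pose t0 := inf S.
have at0 : a <= t0 by apply: lb_le_inf => //; exists t2.
have before s : a <= s -> s < t0 -> posdef (W s).
  move=> as_ st0; apply: contrapT => nps.
  have : t0 <= s by apply: ge_inf => //; exists a.
  by rewrite leNgt st0.
have cW i j : W s i j @[s --> t0] --> W t0 i j.
  exact: is_derive_continuous (dWij _ at0 i j).
(* Otherwise openness would exclude bad times from a neighbourhood of t0, although bad times come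
   arbitrarily close to their infimum. *)
have np0 : ~ posdef (W t0).
  move=> p0; have /nbhs_ballP[e /= e0 he] : \forall s \near t0, (W s)^T = W s -> posdef (W s).
    exact: (posdef_near _ (nbhs t0) _ _ p0 cW).
  have [s [as_ nps] st] := inf_adherent e0 infS.
  have t0s : t0 <= s by apply: ge_inf => //; exists a.
  apply: nps; apply: he; last exact: sW.
  by rewrite /ball/= distrC ger0_norm ?subr_ge0// ltrBlDl.
have at0' : a < t0.
  by rewrite lt_neqAle at0 andbT; apply/eqP => e; apply: np0; rewrite -e.
have dq x : is_derive t0 1 (fun s => qf (W s) x) (qf (dW t0) x).
  by apply: is_derive_qf; exact: dWij.
have semi0 : possemidef (W t0).
  split => [|x]; first exact: sW.
  rewrite leNgt; apply/negP => q0.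
  have x0 : x != 0.
    by apply/eqP => x0; move: q0; rewrite x0 mulmx0 mxE ltxx.
  have hn : \forall s \near t0^'-, qf (W s) x < 0.
    apply: (cvgr_lt (qf (W t0) x)) => //.
    apply: cvg_at_left_filter; exact: is_derive_continuous (dq x).
  have /filter_ex[s [as_ [st0 qs]]] : \forall s \near t0^'-, a <= s /\ (s < t0 /\ qf (W s) x < 0).
    by apply: filterI; [exact: nbhs_left_ge | apply: filterI => //; exact: nbhs_left_lt].
  have [_ /(_ x x0)] := before s as_ st0.
  by rewrite -/(qf _ _) ltNge ltW.
have [x [x0 qx]] : exists x, x != 0 /\ qf (W t0) x = 0.
  apply: contrapT => nx; apply: np0; split => [|x x0]; first exact: sW.
  rewrite lt_neqAle (semi0.2 x) andbT eq_sym; apply/eqP => qx.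
  by apply: nx; exists x.
have kx := possemidef_kernel _ _ semi0 qx.
have := is_derive_gt0_left _ _ _ (dq x) (inward t0 x at0' x0 semi0 kx).
rewrite qx => hn.
have /filter_ex[s [as_ [st0 qs]]] : \forall s \near t0^'-, a <= s /\ (s < t0 /\ qf (W s) x < 0).
  by apply: filterI; [exact: nbhs_left_ge | apply: filterI => //; exact: nbhs_left_lt].
have [_ /(_ x x0)] := before s as_ st0.
by rewrite -/(qf _ _) ltNge ltW.
Qed.

End Barrier.

(** * Riccati equation: symmetry, positivity, convergence *)

Section SingularGronwall.
Context {R : realType}.

(** The product u exp(-G) is nonincreasing and, as G >= 0, at most u, which tends to 0 at 0+. The
    lower bound on G encodes integrability of g at 0: for g(t) = 1/t every antiderivative tends to
    minus infinity there. *)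
Lemma singular_gronwall (u du g G : R -> R) (b : R) : 0 < b ->
  (forall t : R, 0 < t -> t <= b -> is_derive t 1 u (du t)) ->
  (forall t : R, 0 < t -> t <= b -> is_derive t 1 G (g t)) ->
  (forall t : R, 0 < t -> t <= b -> 0 <= u t) ->
  (forall t : R, 0 < t -> t <= b -> 0 <= G t) ->
  (forall t : R, 0 < t -> t <= b -> du t <= g t * u t) ->
  u t @[t --> 0^'+] --> 0 -> u b = 0.
Proof.
move=> b0 hu hG u0 G0 dule ulim.
pose h t := u t * expR (- G t).
pose dh t := (du t - g t * u t) * expR (- G t).
have hh t : 0 < t -> t <= b -> is_derive t 1 h (dh t).
  move=> t0 tb; have ut := hu t t0 tb; have Gt := hG t t0 tb.
  have dE : is_derive t 1 (fun s => expR (- G s)) (expR (- G t) * - g t).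
    exact: (@is_derive1_comp _ expR (fun s => - G s)).
  apply: (@is_derive_eq _ _ _ _ _ _ _ _ (is_deriveM ut dE)).
  by rewrite /dh /GRing.scale/=; ring.
have mono s : 0 < s -> s <= b -> h b <= h s.
  move=> s0 sb.
  have [|||c + hc] := @MVT_segment _ h dh s b => //.
  - by move=> x; rewrite in_itv/= => /andP[sx xb]; apply: hh; [exact: lt_trans sx | exact: ltW].
  - apply: derivable_within_continuous => x; rewrite in_itv/= => /andP[sx xb].
    exact: (@ex_derive _ _ _ _ _ _ _ (hh x (lt_le_trans s0 sx) xb)).
  rewrite in_itv/= => /andP[sc cb].
  rewrite -subr_le0 hc mulr_le0_ge0 ?subr_ge0//.
  rewrite mulr_le0_ge0 ?expR_ge0// subr_le0.
  by apply: dule => //; exact: lt_le_trans sc.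
have hu' s : 0 < s -> s <= b -> h s <= u s.
  move=> s0 sb; rewrite /h ler_piMr ?u0// -expR0 ler_expR oppr_le0.
  exact: G0.
have hb0 : h b <= 0.
  apply: (cvgr_to_ge ulim); near=> s.
  have s0 : 0 < s by near: s; exact: nbhs_right_gt.
  have sb : s <= b by near: s; exact: nbhs_right_le.
  exact: le_trans (mono s s0 sb) (hu' s s0 sb).
apply/eqP; rewrite eq_le u0// andbT.
by move: hb0; rewrite /h pmulr_lle0// expR_gt0.
Unshelve. all: by end_near. Qed.

Lemma bounded_right_of_0 (f : R -> R) (b : R) : 0 < b ->
  (forall t : R, 0 < t -> f s @[s --> t] --> f t) ->
  f s @[s --> 0^'+] --> f 0 ->
  exists K : R, forall t : R, 0 < t -> t <= b -> `|f t| <= K.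
Proof.
move=> b0 cf cf0.
have cn : {within `[0, b], continuous (fun t => `|f t|)}.
  apply/continuous_within_itvP => //; split.
  - move=> t; rewrite in_itv/= => /andP[t0 _].
    by apply: cvg_norm; exact: cf.
  - by apply: cvg_norm.
  - by apply: cvg_norm; apply: cvg_at_left_filter; exact: cf.
have [c _ hc] := EVT_max (ltW b0) cn.
by exists `|f c| => t t0 tb; apply: hc; rewrite in_itv/= tb ltW.
Qed.

End SingularGronwall.

Section Symmetry.
Context {R : realType} {n : nat}.

(** Expanding both products gives 2 n^3 terms of the form 2 a m b, each at most |m| (a^2 + b^2) <= 2
    k u. *)
Lemma frobenius_bound (D N : 'M[R]_n) (k : R) :
  (forall i j, `|N i j| <= k) ->
  \sum_i \sum_j 2 * D i j * (N^T *m D + D *m N) i j <=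
  (4 * n%:R ^+ 3) * k * \sum_i \sum_j D i j ^+ 2.
Proof.
move=> Nk; set u := \sum_i \sum_j D i j ^+ 2.
have Du i j : D i j ^+ 2 <= u.
  rewrite /u (bigD1 i)//= (bigD1 j)//= -addrA lerDl addr_ge0//.
    by apply: sumr_ge0 => l _; exact: sqr_ge0.
  by apply: sumr_ge0 => l _; apply: sumr_ge0 => m _; exact: sqr_ge0.
have key a b m : `|m| <= k -> a ^+ 2 <= u -> b ^+ 2 <= u -> 2 * a * (m * b) <= 2 * k * u.
  move=> mk au bu; have k0 : 0 <= k by exact: le_trans mk.
  apply: (@le_trans _ _ (`|m| * (a ^+ 2 + b ^+ 2))).
    rewrite -[in a ^+ 2]real_normK ?num_real// -[b ^+ 2]real_normK ?num_real//.
    rewrite (le_trans (ler_norm _))// !normrM ger0_norm//.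
    rewrite (_ : 2 * `|a| * (`|m| * `|b|) = `|m| * (2 * `|a| * `|b|)); last by ring.
    rewrite ler_wpM2l// -subr_ge0.
    by rewrite (_ : _ - _ = (`|a| - `|b|) ^+ 2) ?sqr_ge0//; ring.
  rewrite (_ : 2 * k * u = k * (u + u)); last by ring.
  by apply: ler_pM => //; [rewrite addr_ge0 ?sqr_ge0 | exact: lerD].
apply: (@le_trans _ _ (\sum_(i < n) \sum_(j < n) \sum_(l < n) (4 * k * u))).
  apply: ler_sum => i _; apply: ler_sum => j _.
  rewrite !mxE -big_split/= mulr_sumr; apply: ler_sum => l _.
  rewrite mulrDr (_ : 4 * k * u = 2 * k * u + 2 * k * u); last by ring.
  rewrite mxE lerD//; first exact: key.
  by rewrite [_ * N _ _]mulrC; exact: key.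
rewrite !sumr_const !card_ord -!mulrnA -[leLHS]mulr_natr !natrM.
by rewrite le_eqVlt; apply/orP; left; apply/eqP; ring.
Qed.

Definition riccati (Ab S Q P : 'M[R]_n) : 'M[R]_n :=
  Ab^T *m P + P *m Ab - P *m S *m P + Q.

(** The difference P - P^T obeys a linear equation: inserting the cross term P^T S P factors P S P -
    P^T S P^T through P - P^T. *)
Lemma riccati_antisym (Ab S Q P : 'M[R]_n) : S^T = S -> Q^T = Q ->
  let N := Ab - S *m P in
  riccati Ab S Q P - (riccati Ab S Q P)^T = N^T *m (P - P^T) + (P - P^T) *m N.
Proof.
move=> sS sQ N; rewrite /riccati /N.
have -> : (Ab^T *m P + P *m Ab - P *m S *m P + Q)^T =
    P^T *m Ab + Ab^T *m P^T - P^T *m S *m P^T + Q.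
  by rewrite !(linearD, linearN)/= !trmx_mul trmxK sS sQ !mulmxA.
have -> : (Ab - S *m P)^T = Ab^T - P^T *m S.
  by rewrite linearB/= trmx_mul sS.
rewrite !(mulmxBl, mulmxBr) !mulmxA.
set x1 := Ab^T *m P; set x2 := P *m Ab; set x3 := P *m S *m P.
set x4 := P^T *m Ab; set x5 := Ab^T *m P^T; set x6 := P^T *m S *m P^T.
set x7 := P^T *m S *m P.
by apply/matrixP => i j; rewrite !mxE; ring.
Qed.

(** The squared Frobenius norm of P - P^T vanishes at 0+ and satisfies the singular Gronwall
    inequality: P is bounded on (0, b], so only [Ab] contributes a singularity, of order
    t^(-3/4). *)
Lemma riccati_symmetric (Ab : R -> 'M[R]_n) (S Q : 'M[R]_n) (P : R -> 'M[R]_n) (a b : R) :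
  0 < b -> 0 <= a -> S^T = S -> Q^T = Q -> (P 0)^T = P 0 ->
  (forall t : R, 0 < t -> t <= b -> forall i j, `|Ab t i j| <= a * (1 + t `^ (4^-1 - 1))) ->
  (forall t : R, 0 < t -> forall i j,
     is_derive t 1 (fun s => P s i j) (riccati (Ab t) S Q (P t) i j)) ->
  (forall i j, P s i j @[s --> 0^'+] --> P 0 i j) ->
  (P b)^T = P b.
Proof.
move=> b0 a0 sS sQ sP0 Aba dP P0.
have [K hK] : exists K : R, forall t : R, 0 < t -> t <= b -> forall i j, `|P t i j| <= K.
  have /choice[k hk] : forall ij : 'I_n * 'I_n, exists K : R, forall t : R, 0 < t -> t <= b ->
      `|P t ij.1 ij.2| <= K.
    move=> [i j] /=; apply: (bounded_right_of_0 (fun s => P s i j)) => // t t0.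
    exact: is_derive_continuous (dP t t0 i j).
  exists (\sum_ij `|k ij|) => t t0 tb i j.
  rewrite (le_trans (hk (i, j) t t0 tb))// (le_trans (ler_norm _))//.
  by rewrite (bigD1 (i, j))//= lerDl sumr_ge0.
pose D t := P t - (P t)^T.
pose N t := Ab t - S *m P t.
pose u t := \sum_i \sum_j D t i j ^+ 2.
pose du t := \sum_i \sum_j 2 * D t i j * ((N t)^T *m D t + D t *m N t) i j.
pose s := mx_sum_abs S * `|K|.
have s0 : 0 <= s by rewrite mulr_ge0 ?mx_sum_abs_ge0.
pose c : R := 4 * n%:R ^+ 3.
have c0 : 0 <= c by rewrite mulr_ge0 ?exprn_ge0.
pose g t := c * (a * (1 + t `^ (4^-1 - 1)) + s).
(* An antiderivative of [g]; the 4 comes from integrating t^(1/4 - 1). *)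
pose G t := c * ((a + s) * t + a * 4 * t `^ 4^-1).
have hN t : 0 < t -> t <= b -> forall i j,
    `|N t i j| <= a * (1 + t `^ (4^-1 - 1)) + s.
  move=> t0 tb i j; rewrite !mxE (le_trans (ler_normB _ _))// lerD ?Aba//.
  rewrite (le_trans (ler_norm_sum _ _ _))//.
  apply: (@le_trans _ _ (\sum_l `|S i l| * `|K|)).
    apply: ler_sum => l _; rewrite normrM ler_wpM2l//.
    by rewrite (le_trans (hK t t0 tb l j))// ler_norm.
  rewrite -mulr_suml ler_wpM2r// /mx_sum_abs [leRHS](bigD1 i)//= lerDl.
  by apply: sumr_ge0 => k _; exact: sumr_ge0.
have ub0 : u b = 0.
  apply: (singular_gronwall u du g G b b0).
  - move=> t t0 tb.
    have dD i j : is_derive t 1 (fun s => D s i j) (((N t)^T *m D t + D t *m N t) i j).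
      have subT (M : 'M[R]_n) : (M - M^T) i j = M i j - M j i by rewrite !mxE.
      rewrite -(riccati_antisym (Ab t) S Q (P t) sS sQ) subT.
      have -> : (fun s => D s i j) = (fun s => P s i j) - (fun s => P s j i).
        by apply/funext => r; rewrite !mxE.
      exact: (is_deriveB (dP t t0 i j) (dP t t0 j i)).
    apply: is_derive_sumr => i; apply: is_derive_sumr => j.
    have -> : (fun s => D s i j ^+ 2) = (fun s => D s i j) * (fun s => D s i j).
      by apply/funext => r; rewrite expr2.
    apply: (@is_derive_eq _ _ _ _ _ _ _ _ (is_deriveM (dD i j) (dD i j))).
    by rewrite /GRing.scale/=; ring.
  - move=> t t0 tb; have dp := is_derive1_powR 4^-1 t0.
    have -> : G = c *: ((a + s) *: id + (a * 4) *: (fun t => t `^ 4^-1)) by [].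
    apply: is_derive_eq; rewrite /g /GRing.scale/=.
    by field.
  - by move=> t _ _; apply: sumr_ge0 => i _; apply: sumr_ge0 => j _; exact: sqr_ge0.
  - move=> t t0 tb; apply: mulr_ge0 => //; apply: addr_ge0; apply: mulr_ge0.
    + exact: addr_ge0.
    + exact: ltW.
    + exact: mulr_ge0.
    + exact: powR_ge0.
  - by move=> t t0 tb; apply: frobenius_bound; exact: hN.
  rewrite [X in _ --> X](_ : 0 =
      \sum_(i < n) \sum_(j < n) (P 0 i j - P 0 j i) * (P 0 i j - P 0 j i)); last first.
    rewrite big1// => i _; rewrite big1// => j _.
    have -> : P 0 j i = P 0 i j by rewrite -[in LHS]sP0 mxE.
    by rewrite subrr mulr0.
  apply: (cvg_sumr _ 0^'+ _) => i; apply: (cvg_sumr _ 0^'+ _) => j.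
  under eq_fun do rewrite !mxE expr2.
  by apply: cvgM; apply: cvgB; exact: P0.
apply/matrixP => i j; rewrite mxE; apply/eqP; rewrite -subr_eq0 -sqrf_eq0.
have : D b j i ^+ 2 <= u b.
  rewrite /u (bigD1 j)//= (bigD1 i)//= -addrA lerDl addr_ge0//.
    by apply: sumr_ge0 => l _; exact: sqr_ge0.
  by apply: sumr_ge0 => l _; apply: sumr_ge0 => m _; exact: sqr_ge0.
rewrite ub0 !mxE => h.
by rewrite eq_le sqr_ge0 h.
Qed.

End Symmetry.

(** * Comparison with multiples of P* and convergence *)

Section BarrierInequalities.
Context {R : realType}.

(** Here p, s, Qx, m stand for the forms of P*, P* S P*, Q and the perturbation at a contact vector.
    After the term in s is dropped, the worst case is p q ((a - 1)(1/2 - delta/4) + delta/4): decay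
    at rate q/2 leaves room for a perturbation of relative size q delta / 4. *)
Lemma upper_barrier_ineq (a p s Qx m q delta : R) :
  0 < p -> 0 < q -> 0 < delta -> delta <= 1 -> 1 + delta < a ->
  0 <= s -> q * p <= Qx -> m <= q * delta / 4 * p ->
  0 < - (q / 2) * (a - (1 + delta)) * p - ((1 - a) * (a * s + Qx) + a * m).
Proof.
move=> p0 q0 delta0 delta1 a1 s0 Qp mp.
have h1 : 0 <= (a - 1) * (a * s).
  by rewrite !mulr_ge0//; move: a1 delta0; lra.
have h2 : 0 <= (a - 1) * (Qx - q * p).
  by rewrite mulr_ge0// ?subr_ge0//; move: a1 delta0; lra.
have h3 : 0 <= a * (q * delta / 4 * p - m).
  by rewrite mulr_ge0// ?subr_ge0//; move: a1 delta0; lra.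
have h4 : 0 <= p * q * ((a - 1) * (2^-1 - delta / 4)).
  by rewrite !mulr_ge0 ?(ltW p0) ?(ltW q0)//; move: a1 delta0 delta1; lra.
have h5 : 0 < p * q * delta by rewrite !mulr_gt0.
by lra.
Qed.

Lemma lower_barrier_ineq (b p s Qx m q delta : R) :
  0 < p -> 0 < q -> 0 < delta -> delta <= 1 -> 0 < b -> b <= 1 - delta ->
  0 <= s -> q * p <= Qx -> - (q * delta / 4 * p) <= m ->
  0 < (1 - b) * (b * s + Qx) + b * m - - (q / 2) * (b - (1 - delta)) * p.
Proof.
move=> p0 q0 delta0 delta1 b0 b1 s0 Qp mp.
have h1 : 0 <= (1 - b) * (b * s).
  by rewrite !mulr_ge0// ?(ltW b0)//; move: b1 delta0; lra.
have h2 : 0 <= (1 - b) * (Qx - q * p).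
  by rewrite mulr_ge0// ?subr_ge0//; move: b1 delta0; lra.
have h3 : 0 <= b * (q * delta / 4 * p + m).
  by rewrite mulr_ge0// ?(ltW b0)//; move: mp; lra.
have h4 : 0 <= p * q * ((1 - b) * (2^-1 + delta / 4)).
  by rewrite !mulr_ge0 ?(ltW p0) ?(ltW q0)//; move: b1 delta0 delta1; lra.
have h5 : 0 < p * q * delta by rewrite !mulr_gt0.
by lra.
Qed.

End BarrierInequalities.

Section Convergence.
Context {R : realType} {n : nat}.
Variables (A S Q Ps : 'M[R]_n).
Hypothesis sPs : Ps^T = Ps.
Hypothesis are : riccati A S Q Ps = 0.

(** At a contact vector the terms in A form a multiple of A^T P* + P* A, which the algebraic
    equation replaces by P* S P* - Q; then a (s - Q) - a^2 s + Q factors as (1 - a)(a s + Q). *)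
Lemma riccati_qf_scaled (E P : 'M[R]_n) (a : R) (x : 'cV[R]_n) :
  P^T = P -> P *m x = a *: (Ps *m x) ->
  qf (riccati (A + E) S Q P) x =
  (1 - a) * (a * qf (Ps *m S *m Ps) x + qf Q x) + a * qf (E^T *m Ps + Ps *m E) x.
Proof.
move=> sP Px.
have xP : x^T *m P = a *: (x^T *m Ps).
  by rewrite -[LHS]trmxK trmx_mul trmxK sP Px linearZ/= trmx_mul sPs.
have hl M : qf (M *m P) x = a * qf (M *m Ps) x.
  rewrite /qf -!mulmxA Px -!scalemxAr mxE.
  by congr (_ * _).
have hr M : qf (P *m M) x = a * qf (Ps *m M) x.
  rewrite /qf !mulmxA xP -!scalemxAl mxE.
  by congr (_ * _).
have h : qf (A^T *m Ps) x + qf (Ps *m A) x = qf (Ps *m S *m Ps) x - qf Q x.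
  have : qf (riccati A S Q Ps) x = 0 by rewrite are /qf mulmx0 mul0mx mxE.
  by rewrite /riccati !(qfD, qfN); lra.
rewrite /riccati !(qfD, qfN) hl hr hl -!mulmxA hr !mulmxA.
rewrite linearD/= mulmxDl mulmxDr !qfD.
have -> : qf Q x = qf (Ps *m S *m Ps) x - (qf (A^T *m Ps) x + qf (Ps *m A) x) by rewrite h; ring.
by ring.
Qed.

Variables (E P : R -> 'M[R]_n) (q delta T : R).
Hypothesis pPs : posdef Ps.
Hypothesis S0 : forall x, 0 <= qf (Ps *m S *m Ps) x.
Hypothesis pP : forall t : R, 0 < t -> posdef (P t).
Hypothesis dP : forall t : R, 0 < t -> forall i j,
  is_derive t 1 (fun s => P s i j) (riccati (A + E t) S Q (P t) i j).
Hypothesis q0 : 0 < q.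
Hypothesis qQ : forall x, q * qf Ps x <= qf Q x.
Hypothesis delta0 : 0 < delta.
Hypothesis delta1 : delta < 1.
Hypothesis T0 : 0 < T.
Hypothesis smallE : forall t, T <= t -> forall x,
  `|qf ((E t)^T *m Ps + Ps *m E t) x| <= q * delta / 4 * qf Ps x.

(** The solution of a' = - (q/2)(a - m) with a(T) = m + c: c covers the initial gap at time T and is
    then forgotten exponentially. *)
Definition relax (m c t : R) : R := m + c * expR (- (q / 2 * (t - T))).

Lemma relax_init (m c : R) : relax m c T = m + c.
Proof. by rewrite /relax subrr mulr0 oppr0 expR0 mulr1. Qed.

Lemma is_derive_relax (m c t : R) : is_derive t 1 (relax m c) (- (q / 2) * (relax m c t - m)).
Proof.
have dl : is_derive t 1 (fun s : R => - (q / 2 * (s - T))) (- (q / 2)).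
  have -> : (fun s : R => - (q / 2 * (s - T))) = (- (q / 2)) *: (id - cst T).
    by apply/funext => s; rewrite /GRing.scale/= -mulNr.
  by apply: is_derive_eq; rewrite /GRing.scale/= subr0 mulr1.
have dE := @is_derive1_comp _ expR _ _ _ _ (is_derive_expR _) dl.
rewrite [X in is_derive _ _ _ X](_ : _ = c * (expR (- (q / 2 * (t - T))) * - (q / 2))); last first.
  by rewrite /relax; ring.
have -> : relax m c = cst m + c *: (expR \o fun s : R => - (q / 2 * (s - T))) by [].
by apply: is_derive_eq; rewrite /GRing.scale/= add0r.
Qed.

Lemma relax_expR_itv (t : R) : T <= t -> 0 < expR (- (q / 2 * (t - T))) <= 1.
Proof.
move=> Tt; rewrite expR_gt0/= -[leRHS]expR0 ler_expR oppr_le0.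
by rewrite mulr_ge0 ?divr_ge0 ?subr_ge0// ltW.
Qed.

Lemma is_derive_scaled_entry (a : R -> R) (da : R) (t : R) : 0 < t -> is_derive t 1 a da ->
  forall i j, is_derive t 1 (fun s => (a s *: Ps - P s) i j)
    ((da *: Ps - riccati (A + E t) S Q (P t)) i j).
Proof.
move=> t0 dat i j; rewrite [X in is_derive _ _ _ X]mxE [X in X + _]mxE [X in _ + X]mxE.
have -> : (fun s => (a s *: Ps - P s) i j) = Ps i j *: a - (fun s => P s i j).
  by apply/funext => s; rewrite !mxE /GRing.scale/= mulrC.
rewrite mulrC; exact: (is_deriveB (is_deriveZ _ dat) (dP t t0 i j)).
Qed.

(** A kernel vector of a P* - P is exactly a contact vector P x = a P* x, so the barrier lemma asks
    only for the scalar inequality above. *)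
Lemma riccati_upper (c : R) : 0 < c -> posdef ((1 + delta + c) *: Ps - P T) ->
  forall t : R, T <= t -> posdef (relax (1 + delta) c t *: Ps - P t).
Proof.
move=> c0 pT.
pose a := relax (1 + delta) c.
apply: (posdef_barrier n (fun t => a t *: Ps - P t)
  (fun t => (- (q / 2) * (a t - (1 + delta))) *: Ps - riccati (A + E t) S Q (P t)) T).
- move=> t Tt; have [sP _] := pP t (lt_le_trans T0 Tt).
  by rewrite linearB/= linearZ/= sPs sP.
- move=> t Tt; apply: is_derive_scaled_entry; first exact: lt_le_trans Tt.
  exact: is_derive_relax.
- by rewrite /a relax_init.
move=> t x Tt x0 _ /eqP; rewrite mulmxBl subr_eq0 -scalemxAl => /eqP/esym Px.
have [sP _] := pP t (lt_trans T0 Tt).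
rewrite qfB qfZ (riccati_qf_scaled _ _ _ _ sP Px).
have p0 : 0 < qf Ps x := pPs.2 x x0.
have := smallE t (ltW Tt) x; rewrite ler_norml => /andP[_].
have := qQ x; have := S0 x.
have a1 : 1 + delta < a t.
  rewrite /a /relax ltrDl mulr_gt0//.
  by have /andP[] := relax_expR_itv t (ltW Tt).
by move=> s0 Qp mp; apply: (upper_barrier_ineq _ _ _ _ _ _ _ p0 q0 delta0 (ltW delta1) a1 s0 Qp mp).
Qed.

(** The bound c < 1 - delta keeps the lower barrier positive, as the scalar inequality requires. *)
Lemma riccati_lower (c : R) : 0 <= c -> c < 1 - delta -> posdef (P T - (1 - delta - c) *: Ps) ->
  forall t : R, T <= t -> posdef (P t - relax (1 - delta) (- c) t *: Ps).
Proof.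
move=> c0 c1 pT.
pose b := relax (1 - delta) (- c).
apply: (posdef_barrier n (fun t => P t - b t *: Ps)
  (fun t => riccati (A + E t) S Q (P t) - (- (q / 2) * (b t - (1 - delta))) *: Ps) T).
- move=> t Tt; have [sP _] := pP t (lt_le_trans T0 Tt).
  by rewrite linearB/= linearZ/= sPs sP.
- move=> t Tt i j.
  have -> : (fun s => (P s - b s *: Ps) i j) = - (fun s => (b s *: Ps - P s) i j).
    by apply/funext => s; rewrite -[in LHS]opprB mxE.
  rewrite -[X in fun_of_matrix X]opprB mxE.
  apply: is_deriveN; apply: is_derive_scaled_entry; first exact: lt_le_trans Tt.
  exact: is_derive_relax.
- by rewrite /b relax_init.
move=> t x Tt x0 _ /eqP; rewrite mulmxBl subr_eq0 -scalemxAl => /eqP Px.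
have [sP _] := pP t (lt_trans T0 Tt).
rewrite qfB qfZ (riccati_qf_scaled _ _ _ _ sP Px).
have p0 : 0 < qf Ps x := pPs.2 x x0.
have := smallE t (ltW Tt) x; rewrite ler_norml => /andP[+ _].
have := qQ x; have := S0 x.
have [b0 b1] : 0 < b t /\ b t <= 1 - delta.
  rewrite /b /relax; have /andP[e0 e1] := relax_expR_itv t (ltW Tt).
  move: (expR _) e0 e1 => e e0 e1.
  have : c * e <= c by rewrite ler_piMr.
  have : 0 <= c * e by rewrite mulr_ge0// ltW.
  by move: c1; lra.
by move=> s0 Qp mp; apply: (lower_barrier_ineq _ _ _ _ _ _ _ p0 q0 delta0 (ltW delta1) b0 b1 s0 Qp mp).
Qed.

Lemma relax_small (c : R) : 0 <= c -> \forall t \near +oo, c * expR (- (q / 2 * (t - T))) <= delta.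
Proof.
move=> c0; near=> t.
(* Chosen so that (q/2)(t - T) >= c / delta; then exp(y) >= 1 + y suffices. *)
have tT : T + 2 * c / (q * delta) <= t.
  by near: t; apply: nbhs_pinfty_ge; rewrite num_real.
rewrite expRN ler_pdivrMr ?expR_gt0// mulrC -ler_pdivrMr//.
apply: le_trans (expR_ge1Dx _).
apply: (@le_trans _ _ (q / 2 * (t - T))); last by rewrite lerDr.
rewrite -lerBrDl in tT.
apply: (@le_trans _ _ (q / 2 * (2 * c / (q * delta)))).
  by rewrite le_eqVlt; apply/orP; left; apply/eqP; field; rewrite !gt_eqF.
by rewrite ler_wpM2l// divr_ge0// ltW.
Unshelve. all: by end_near. Qed.

Lemma riccati_relative_error : \forall t \near +oo, forall x,
  `|qf (P t - Ps) x| <= 2 * delta * qf Ps x.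
Proof.
have [k k0 hk] := posdef_coercive _ _ pPs.
have [kT kT0 hkT] := posdef_coercive _ _ (pP T T0).
have P0 x : 0 <= qf Ps x := (posdef_semi _ pPs).2 x.
have [sPT _] := pP T T0.
(* Coercivity of P* gives P(T) <= ([mx_sum_abs (P T)] / k) P*; the added 1 ensures cu > 0. *)
pose cu := mx_sum_abs (P T) / k + 1.
have cu0 : 0 < cu by rewrite ltr_wpDl// divr_ge0 ?mx_sum_abs_ge0// ltW.
have hu : posdef ((1 + delta + cu) *: Ps - P T).
  split => [|x x0]; first by rewrite linearB/= linearZ/= sPs sPT.
  rewrite -/(qf _ _) qfB qfZ subr_gt0.
  apply: (@le_lt_trans _ _ (mx_sum_abs (P T) * sqn x)).
    by rewrite (le_trans (ler_norm _))// qf_abs_le.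
  have p0 : 0 < qf Ps x := pPs.2 x x0.
  have : mx_sum_abs (P T) * sqn x <= mx_sum_abs (P T) / k * qf Ps x.
    rewrite -mulrA ler_wpM2l ?mx_sum_abs_ge0//.
    by rewrite mulrC ler_pdivlMr// mulrC.
  move=> /le_lt_trans; apply; rewrite ltr_pM2r// /cu.
  by move: delta0; lra.
pose K := mx_sum_abs Ps + 1.
have K0 : 0 < K by rewrite ltr_wpDl ?mx_sum_abs_ge0.
have ub_Ps x : x != 0 -> qf Ps x < K * sqn x.
  move=> x0; apply: (@le_lt_trans _ _ (mx_sum_abs Ps * sqn x)).
    by rewrite (le_trans (ler_norm _))// qf_abs_le.
  by rewrite ltr_pM2r ?sqn_gt0// ltrDl.
(* Since P(T) >= kT |x|^2 and P* is below K |x|^2, the matrix P(T) lies above b0 P*; the lower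
   barrier starts at b0. *)
pose b0 := Num.min (1 - delta) (kT / K).
have b00 : 0 < b0 by rewrite lt_min subr_gt0 delta1 divr_gt0.
have b01 : b0 <= 1 - delta by rewrite ge_min lexx.
have hl : posdef (P T - (1 - delta - (1 - delta - b0)) *: Ps).
  rewrite subKr.
  split => [|x x0]; first by rewrite linearB/= linearZ/= sPs sPT.
  rewrite -/(qf _ _) qfB qfZ subr_gt0; apply: lt_le_trans (hkT x).
  apply: (@lt_le_trans _ _ (b0 * (K * sqn x))); first by rewrite ltr_pM2l// ub_Ps.
  by rewrite mulrA ler_wpM2r ?sqn_ge0// -ler_pdivlMr// ge_min lexx orbT.
have cl0 : 0 <= 1 - delta - b0 by rewrite subr_ge0.
have cl1 : 1 - delta - b0 < 1 - delta by rewrite ltrBlDr ltrDl.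
have upper := riccati_upper _ cu0 hu.
have lower := riccati_lower _ cl0 cl1 hl.
near=> t.
have Tt : T <= t by near: t; apply: nbhs_pinfty_ge; rewrite num_real.
have su : cu * expR (- (q / 2 * (t - T))) <= delta.
  by near: t; apply: relax_small; exact: ltW.
have sl : (1 - delta - b0) * expR (- (q / 2 * (t - T))) <= delta.
  by near: t; exact: relax_small.
move=> x; rewrite qfB ler_distl.
have := (posdef_semi _ (upper t Tt)).2 x; have := (posdef_semi _ (lower t Tt)).2 x.
rewrite -!/(qf _ _) !(qfB, qfZ) /relax !subr_ge0 => hlo hup.
have p0 := P0 x.
apply/andP; split.
  apply: le_trans hlo; rewrite -{1}[qf Ps x]mul1r -mulrBl ler_wpM2r//.
  by rewrite mulNr; move: sl; lra.
apply: (le_trans hup); rewrite -{2}[qf Ps x]mul1r -mulrDl ler_wpM2r//.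
by move: su; lra.
Unshelve. all: by end_near. Qed.

End Convergence.

(** The two barriers give an error relative to P* for each delta; polarization on basis vectors
    makes it entrywise. The rate q compares the coercivity of Q with an upper bound for P*. *)
Lemma riccati_cvg (R : realType) n (A S Q Ps : 'M[R]_n) (E P : R -> 'M[R]_n) :
  posdef Q -> posdef Ps -> (forall x, 0 <= qf S x) -> riccati A S Q Ps = 0 ->
  (forall t : R, 0 < t -> posdef (P t)) ->
  (forall t : R, 0 < t -> forall i j,
    is_derive t 1 (fun s => P s i j) (riccati (A + E t) S Q (P t) i j)) ->
  (forall i j, E t i j @[t --> +oo] --> 0) ->
  forall i j, P t i j @[t --> +oo] --> Ps i j.
Proof.
move=> pQ pPs S0 are pP dP E0 i j.
have [sPs _] := pPs.
have [k k0 hk] := posdef_coercive _ _ pPs.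
have [cQ cQ0 hQ] := posdef_coercive _ _ pQ.
pose K := mx_sum_abs Ps + 1.
have K0 : 0 < K by rewrite ltr_wpDl ?mx_sum_abs_ge0.
pose q := cQ / K.
have q0 : 0 < q by rewrite divr_gt0.
have qQ x : q * qf Ps x <= qf Q x.
  apply: le_trans (hQ x); rewrite /q mulrAC ler_pdivrMr// -mulrA ler_wpM2l ?(ltW cQ0)//.
  rewrite (le_trans (ler_norm _))// (le_trans (qf_abs_le _ _))// mulrC.
  by rewrite ler_wpM2l ?sqn_ge0// lerDl.
have PSP0 x : 0 <= qf (Ps *m S *m Ps) x.
  have -> : qf (Ps *m S *m Ps) x = qf S (Ps *m x).
    by rewrite /qf trmx_mul sPs !mulmxA.
  exact: S0.
pose x : 'cV[R]_n := delta_mx i 0; pose y : 'cV[R]_n := delta_mx j 0.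
pose C := qf Ps (x + y) + qf Ps x + qf Ps y.
have P0 z : 0 <= qf Ps z := (posdef_semi _ pPs).2 z.
have C0 : 0 <= C by rewrite !addr_ge0.
have C10 : 0 < C + 1 by rewrite ltr_wpDl.
apply/cvgrPdist_lt => e e0.
(* The factor 2 of polarization cancels the 2 of the relative error, leaving delta C < e; C + 1 is
   positive because C >= 0. *)
pose delta := Num.min (2^-1) (e / (C + 1)).
have delta0 : 0 < delta by rewrite lt_min invr_gt0 ltr0n divr_gt0.
have delta1 : delta < 1.
  by rewrite gt_min invf_lt1 ?ltr0n// ltr1n.
have deltaC : delta * C < e.
  apply: (@le_lt_trans _ _ (e / (C + 1) * C)).
    by rewrite ler_wpM2r// ge_min lexx orbT.
  by rewrite mulrAC ltr_pdivrMr// ltr_pM2l// ltrDl.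
have ME0 k1 k2 : ((E t)^T *m Ps + Ps *m E t) k1 k2 @[t --> +oo] --> (0 : 'M[R]_n) k1 k2.
  have -> : (0 : 'M[R]_n) k1 k2 =
      \sum_(l < n) 0 * Ps l k2 + \sum_(l < n) Ps k1 l * 0.
    by rewrite mxE !big1 ?addr0// => l _; rewrite ?mul0r ?mulr0.
  under eq_fun do rewrite !mxE.
  apply: cvgD; apply: (cvg_sumr _ +oo _) => l.
    under eq_fun do rewrite mxE.
    by apply: cvgM; [exact: E0 | exact: cvg_cst].
  by apply: cvgM; [exact: cvg_cst | exact: E0].
have eps0 : 0 < q * delta / 4 * k by do 2?apply: mulr_gt0 => //; apply: mulr_gt0.
have [M [Mr hM]] := qf_cvg_near _ +oo _ _ _ eps0 ME0.
pose T := Num.max M 0 + 1.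
have T0 : 0 < T by rewrite ltr_wpDl// le_max lexx orbT.
have smallE t : T <= t -> forall z,
    `|qf ((E t)^T *m Ps + Ps *m E t) z| <= q * delta / 4 * qf Ps z.
  move=> Tt z; have Mt : M < t.
    apply: lt_le_trans Tt; apply: (@le_lt_trans _ _ (Num.max M 0)); first by rewrite le_max lexx.
    by rewrite ltrDl.
  have := hM t Mt z; rewrite /qf mulmx0 mul0mx [(0 : 'M[R]_1) 0 0]mxE subr0 => /le_trans; apply.
  by rewrite -mulrA ler_wpM2l ?hk// divr_ge0// mulr_ge0// ltW.
have := riccati_relative_error A S Q Ps sPs are E P q delta T pPs PSP0 pP dP q0 qQ
  delta0 delta1 T0 smallE.
move=> near_err; near=> t.
have err z : `|qf (P t - Ps) z| <= 2 * delta * qf Ps z.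
  by move: z; near: t; exact: near_err.
have t0 : 0 < t by near: t; apply: nbhs_pinfty_gt; rewrite num_real.
have sX : (P t - Ps)^T = P t - Ps.
  by have [sP _] := pP t t0; rewrite linearB/= sP sPs.
rewrite distrC.
have -> : P t i j - Ps i j = (P t - Ps) i j by rewrite !mxE.
have h2 : `|2 * (P t - Ps) i j| <= 2 * delta * C.
  rewrite qf_polar// -/x -/y /C !mulrDr.
  rewrite (le_trans (ler_normB _ _))// lerD ?err//.
  by rewrite (le_trans (ler_normB _ _))// lerD ?err.
apply: le_lt_trans deltaC.
by move: h2; rewrite normrM ger0_norm// -mulrA ler_pM2l.
Unshelve. all: by end_near. Qed.

Section PositivityAndBounds.
Context {R : realType}.

(** At a kernel vector of P every term of the equation vanishes except x^T Q x > 0. The barrier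
    starts at a small s > 0, reached from 0 by right continuity, because the equation holds only for
    positive times. *)
Lemma riccati_posdef n (Ab : R -> 'M[R]_n) (S Q : 'M[R]_n) (P : R -> 'M[R]_n) :
  posdef Q -> posdef (P 0) ->
  (forall t : R, 0 < t -> (P t)^T = P t) ->
  (forall t : R, 0 < t -> forall i j,
     is_derive t 1 (fun s => P s i j) (riccati (Ab t) S Q (P t) i j)) ->
  (forall i j, P s i j @[s --> 0^'+] --> P 0 i j) ->
  forall t : R, 0 < t -> posdef (P t).
Proof.
move=> pQ p0 sP dP P0 t t0.
have near0 : \forall s \near 0^'+, (P s)^T = P s -> posdef (P s).
  exact: (posdef_near _ 0^'+ _ _ p0 P0).
have /filter_ex[s [s0 [st ps]]] : \forall s \near 0^'+,
    0 < s /\ (s < t /\ ((P s)^T = P s -> posdef (P s))).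
  apply: filterI; first exact: nbhs_right_gt.
  by apply: filterI => //; exact: nbhs_right_lt.
apply: (posdef_barrier n P (fun r => riccati (Ab r) S Q (P r)) s) => //.
- by move=> r sr; apply: sP; exact: lt_le_trans sr.
- by move=> r sr; apply: dP; exact: lt_le_trans sr.
- by apply: ps; exact: sP.
- move=> r x sr x0 _ Px.
  have sPr := sP r (lt_trans s0 sr).
  have xP : x^T *m P r = 0 by rewrite -[LHS]trmxK trmx_mul trmxK sPr Px trmx0.
  have -> : qf (riccati (Ab r) S Q (P r)) x = qf Q x.
    rewrite /riccati !(qfD, qfN) /qf -!mulmxA Px !mulmx0 !mulmxA xP !mul0mx.
    by rewrite !mxE; ring.
  exact: pQ.2.
exact: ltW.
Qed.

Lemma posdef_inv_qf_ge0 n (M : 'M[R]_n) (x : 'cV[R]_n) : posdef M -> 0 <= qf (invmx M) x.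
Proof.
move=> pM; have [sM _] := pM.
have [uM | nuM] := boolP (M \in unitmx).
  have -> : qf (invmx M) x = qf M (invmx M *m x).
    by rewrite /qf trmx_mul trmx_inv sM -!mulmxA mulKVmx.
  exact: (posdef_semi _ pM).2.
(* On a non-invertible matrix [invmx] is the identity map. *)
by rewrite /invmx (negbTE nuM); exact: (posdef_semi _ pM).2.
Qed.

(** Gronwall runs up to an arbitrary time b, beyond D: there [f] is bounded and t^(1/4) >=
    D^(1/4). *)
Lemma small_time_bound_extend (f : R -> R) (C D b : R) : 0 < D -> 0 < b ->
  {within [set t : R | 0 <= t], continuous f} ->
  (forall t, 0 < t -> t <= D -> `|f t| <= C * t `^ (4^-1)) ->
  exists K, forall t, 0 < t -> t <= b -> `|f t| <= K * t `^ (4^-1).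
Proof.
move=> D0 b0 cf fC.
have cn : {within `[0, b], continuous (fun t => `|f t|)}.
  have cf' : {within `[0, b], continuous f}.
    by apply: continuous_subspaceW cf => t /=; rewrite in_itv/= => /andP[].
  by move=> t; apply: cvg_norm; exact: cf'.
have [c _ hc] := EVT_max (ltW b0) cn.
have D4 : 0 < D `^ (4^-1) by rewrite powR_gt0.
exists (`|C| + `|f c| / D `^ (4^-1)) => t t0 tb.
have [tD|Dt] := leP t D.
  rewrite (le_trans (fC t t0 tD))// ler_wpM2r ?powR_ge0//.
  by rewrite (le_trans (ler_norm C))// lerDl divr_ge0// ltW.
apply: (@le_trans _ _ (`|f c|)); first by apply: hc; rewrite in_itv/= tb ltW.
apply: (@le_trans _ _ (`|f c| / D `^ 4^-1 * t `^ 4^-1)).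
  rewrite mulrAC -mulrA ler_peMr// ler_pdivlMr// mul1r.
  by apply: ge0_ler_powR; rewrite ?nnegrE ?ltW// ltW.
by rewrite ler_wpM2r ?powR_ge0// lerDr.
Qed.

Lemma Abar_bound (T : Type) n N (A : 'M[R]_n) (Delta : 'I_N -> 'M[R]_n)
    (w : 'I_N -> R -> T -> R) (om : T) (b : R) :
  (forall i, exists K, forall t, 0 < t -> t <= b -> `|w i t om| <= K * t `^ (4^-1)) ->
  exists2 a, 0 <= a & forall t : R, 0 < t -> t <= b -> forall i j,
    `|Abar A Delta w om t i j| <= a * (1 + t `^ (4^-1 - 1)).
Proof.
move=> /choice[K hK].
exists (mx_sum_abs A + \sum_i `|K i| * mx_sum_abs (Delta i)).
  by rewrite addr_ge0 ?mx_sum_abs_ge0// sumr_ge0// => i _; rewrite mulr_ge0 ?mx_sum_abs_ge0.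
move=> t t0 tb k l.
have entry (M : 'M[R]_n) : `|M k l| <= mx_sum_abs M.
  rewrite /mx_sum_abs (bigD1 k)//= (bigD1 l)//= -addrA lerDl addr_ge0//.
    exact: sumr_ge0.
  by apply: sumr_ge0 => i _; exact: sumr_ge0.
have pw : t `^ (4^-1 - 1) = t `^ 4^-1 / t.
  by rewrite powRB ?powRr1 ?(ltW t0)// implybE (gt_eqF t0) orbT.
have -> : Abar A Delta w om t k l = A k l + \sum_i (t^-1 * w i t om) * Delta i k l.
  rewrite /Abar !mxE summxE mulr_sumr; congr (_ + _); apply: eq_bigr => i _.
  by rewrite mxE mulrA.
have p0 : 0 <= t `^ (4^-1 - 1) by exact: powR_ge0.
rewrite mulrDr mulr1 (le_trans (ler_normD _ _))// -addrA lerD ?entry//.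
apply: (@le_trans _ _ ((\sum_i `|K i| * mx_sum_abs (Delta i)) * t `^ (4^-1 - 1))).
  rewrite mulr_suml (le_trans (ler_norm_sum _ _ _))//; apply: ler_sum => i _.
  rewrite normrM mulrAC ler_pM ?entry// pw normrM mulrC normfV (gtr0_norm t0).
  rewrite mulrA ler_wpM2r ?invr_ge0 ?(ltW t0)// (le_trans (hK i t t0 tb))//.
  by rewrite ler_wpM2r ?powR_ge0// ler_norm.
apply: ler_wpDl.
  by apply: sumr_ge0 => i _; rewrite mulr_ge0 ?mx_sum_abs_ge0.
by rewrite ler_wpM2r// lerDr mx_sum_abs_ge0.
Qed.

End PositivityAndBounds.

(** * From Brownian motions to deterministic paths *)

Section BrownianPaths.
Context {R : realType} {d : measure_display} {T : measurableType d}.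

(** All that the deterministic part asks of a path: behaviour at infinity for the limit, behaviour
    at 0 for symmetry. *)
Definition tame_path (f : R -> R) : Prop :=
  [/\ {within [set t : R | 0 <= t], continuous f},
      (fun t => t^-1 * f t) @ +oo --> 0 &
      exists C D : R, 0 < D /\
        forall t, 0 < t -> t <= D -> `|f t| <= C * t `^ (4^-1)].

Lemma indep_std_BMs_tame (Pr : probability T R) (F : R -> set (set T)) (N : nat)
    (w : 'I_N -> R -> T -> R) :
  filtration F -> (forall (i : 'I_N) (t : R), 0 <= t -> measurable_wrt (F t) (w i t)) ->
  indep_std_BMs Pr w ->
  {ae Pr, forall om, forall i, tame_path (fun t => w i t om)}.
Proof.
move=> hF hadapt [[Z0 [mZ0 [PZ0 hZ0]]] hincr].
have mw i t : 0 <= t -> measurable_fun setT (w i t).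
  move=> t0 _ Y mY; rewrite setTI.
  have [_ FM] := hF.1 t t0.
  by apply: FM; exact: hadapt.
have incr i s t : 0 <= s -> s < t ->
    centered_normal Pr (t - s) (fun om => w i t om - w i s om).
  move=> s0 st.
  (* One increment suffices: the grid is s, t, t, ..., required to increase only at its first
     step. *)
  have [] := hincr 1%N (fun j => if j is 0%N then s else t) s0.
    by case.
  by move=> _ /(_ (i, ord0)).
have path0 : {ae Pr, forall om, forall i, w i 0 om = 0 /\
    {within [set t : R | 0 <= t], continuous (fun t => w i t om)}}.
  exists Z0; split => // om /= h; apply: contrapT => /hZ0 h0.
  exact: h h0.
have tame i : {ae Pr, forall om, tame_path (fun t => w i t om)}.
  have g1 := brownian_growth_as Pr (w i) (mw i) (incr i).
  have g2 := brownian_small_time_as Pr (w i) (mw i) (incr i).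
  apply: filterS3 path0 g1 g2 => om /(_ i)[w0 cw] h1 h2; split => //.
    exact: h1.
  have [C [D [_ D0 hD]]] := h2 w0 cw.
  by exists C, D.
exact: (filter_forall _ tame).
Qed.

End BrownianPaths.

Theorem mainTheorem9 (R : realType) (n m : nat)
  (A : 'M[R]_n) (B : 'M[R]_(n, m)) (Q : 'M[R]_n) (Rm : 'M[R]_m)
  (Qh : 'M[R]_n) (Pstar : 'M[R]_n)
  (hAB : stabilizable A B) (hQ : posdef Q) (hR : posdef Rm)
  (hQh : possemidef Qh /\ Qh *m Qh = Q) (hobs : observable A Qh)
  (hPstar : posdef Pstar) (hARE : ARE A B Q Rm Pstar)
  (d : measure_display) (T : measurableType d) (Pr : probability T R)
  (hcomplete : complete_prob Pr)
  (F : R -> set (set T)) (hF : filtration F)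
  (N : nat) (w : 'I_N -> R -> T -> R) (hw : indep_std_BMs Pr w)
  (hadapt : forall (i : 'I_N) (t : R), 0 <= t -> measurable_wrt (F t) (w i t))
  (Delta : 'I_N -> 'M[R]_n) :
  exists Z : set T, measurable Z /\ Pr Z = 0%E /\
    forall om : T, ~ Z om ->
      forall Pf : R -> 'M[R]_n,
        solves_DRE (Abar A Delta w om) B Q Rm Pf -> posdef (Pf 0) ->
        forall i j : 'I_n, (fun t => Pf t i j) @ +oo --> Pstar i j.
Proof.
have [Z [mZ PZ hZ]] := indep_std_BMs_tame Pr F N w hF hadapt hw.
(* The null set is fixed before the solution [Pf]; from here on the argument is deterministic. *)
exists Z; split => //; split => // om nZ Pf [dP P0] pP0.
have tame i : tame_path (fun t => w i t om).
  by move: i; apply: contrapT => nt; apply: nZ; exact: hZ.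
pose S := B *m invmx Rm *m B^T.
have sS : S^T = S by rewrite /S !trmx_mul trmxK trmx_inv hR.1 mulmxA.
have S0 x : 0 <= qf S x.
  have -> : qf S x = qf (invmx Rm) (B^T *m x) by rewrite /qf trmx_mul trmxK !mulmxA.
  exact: posdef_inv_qf_ge0.
have ricE (Ab P : 'M[R]_n) :
    Ab^T *m P + P *m Ab - P *m B *m invmx Rm *m B^T *m P + Q = riccati Ab S Q P.
  by rewrite /riccati /S !mulmxA.
have dP' (t : R) : 0 < t -> forall i j,
    is_derive t 1 (fun s => Pf s i j) (riccati (Abar A Delta w om t) S Q (Pf t) i j).
  by move=> t0 i j; rewrite -ricE; exact: dP.
have sP t : 0 < t -> (Pf t)^T = Pf t.
  move=> t0.
  have [a a0 ha] : exists2 a, 0 <= a & forall s : R, 0 < s -> s <= t -> forall i j,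
      `|Abar A Delta w om s i j| <= a * (1 + s `^ (4^-1 - 1)).
    apply: Abar_bound => i; have [cw _ [C [D [D0 hD]]]] := tame i.
    exact: (small_time_bound_extend (fun s => w i s om) C D).
  exact: (riccati_symmetric (Abar A Delta w om) S Q Pf a t t0 a0 sS hQ.1 pP0.1 ha dP' P0).
have pP : forall t, 0 < t -> posdef (Pf t).
  exact: (riccati_posdef n (Abar A Delta w om) S Q Pf hQ pP0 sP dP' P0).
pose E t := t^-1 *: (\sum_(i < N) w i t om *: Delta i).
apply: (riccati_cvg R n A S Q Pstar E Pf) => //.
  by rewrite -ricE.
move=> k l.
have -> : (0 : R) = \sum_(i < N) 0 * Delta i k l by rewrite big1// => i _; rewrite mul0r.
have -> : (fun t => E t k l) = fun t => \sum_(i < N) (t^-1 * w i t om) * Delta i k l.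
  apply/funext => t; rewrite /E mxE summxE mulr_sumr; apply: eq_bigr => i _.
  by rewrite mxE mulrA.
apply: (cvg_sumr _ +oo _) => i; apply: cvgM; last exact: cvg_cst.
by have [] := tame i.
Qed.
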